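(* For any non-negative integer $n$ and $\varphi\in\mathrm{Exp}_n$, the $\mathcal{H}$-module $\mathbf{W}(\varphi)$ is (isomorphic to) an irreducible quotient of the $\mathcal{H}$-module $\mathbf{M}_n$. Moreover, if $\mathbb{k}$ is algebraically closed, then any irreducible quotient of the $\mathcal{H}$-module $\mathbf{M}_n$ is isomorphic to $\mathbf{W}(\varphi)$ for some $\varphi\in\mathrm{Exp}_n$.
   Context: Let $\mathbb{k}$ be a field of characteristic zero. Let $\mathrm{sl}(2)$ be the Lie algebra over $\mathbb{k}$ with basis $e,f,h$ and $[e,f]=h$, $[h,e]=2e$, $[h,f]=-2f$. Let $\mathfrak{g}=\mathrm{sl}(2)\otimes\mathbb{k}[t^{\pm1}]$ be the loop algebra, with $x(k)=x\otimes t^k$ and $[x(k),y(l)]=[x,y](k+l)$, $\mathbb{Z}$-graded by degree in $t$. Put $\mathcal{E}=\bigoplus_{j\in\mathbb{Z}}\mathbb{k}e(j)$, $\mathcal{H}=\bigoplus_{j\in\mathbb{Z}}\mathbb{k}h(j)$, $\mathcal{F}=\bigoplus_{j\in\mathbb{Z}}\mathbb{k}f(j)$. Let $\mathbf{M}(0)=\mathrm{Ind}_{\mathcal{H}\oplus\mathcal{E}}^{\mathfrak{g}}\,\mathbb{k}u_0$ be the $\mathfrak{g}$-module induced from the one-dimensional module $\mathbb{k}u_0$ with $(\mathcal{H}\oplus\mathcal{E})\cdot u_0=0$. For $n\geq 0$, $\mathbf{M}_n=\{v\in\mathbf{M}(0): h(0)v=-2nv\}$ is the $n$-th layer, an $\mathcal{H}$-module;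 it is spanned by the elements $f(\chi_1)\cdots f(\chi_n)u_0$, $\chi\in\mathbb{Z}^n$, and graded by $\deg f(\chi_1)\cdots f(\chi_n)u_0=\sum_i\chi_i$. All modules carry a $\mathbb{Z}$-grading compatible with that of the acting algebra; submodules and quotients are graded, and a non-zero module is irreducible if it has no proper non-zero graded submodule. For a function $\varphi:\mathbb{Z}\to\mathbb{k}$, let $\tilde\varphi:U(\mathcal{H})\to\mathbb{k}[t^{\pm1}]$ be the homomorphism of graded algebras with $\tilde\varphi(h(k))=\varphi(k)t^k$, $k\in\mathbb{Z}$. $\mathbf{W}(\varphi)$ denotes the image of $\tilde\varphi$, considered as a graded $\mathcal{H}$-module via $\tilde\varphi$ (i.e. $h(k)$ acts by multiplication by $\varphi(k)t^k$). For $n\geq0$, $\mathrm{Exp}_n$ is the set of all functions $\varphi:\mathbb{Z}\to\mathbb{k}$ of the form $\varphi(k)=-2\sum_{i=1}^n\alpha_i^k$, $k\in\mathbb{Z}$, for some non-zero $\alpha_1,\dots,\alpha_n\in\mathbb{k}$ (so $\mathrm{Exp}_0=\{0\}$). *)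

(* Defs.v *)
From HB Require Import structures.
From mathcomp Require Import all_boot all_order all_algebra.
From mathcomp Require Import finmap generic_quotient ring_quotient.
From mathcomp.classical Require Import boolp.
From mathcomp.multinomials Require Import monalg.

Set Implicit Arguments.
Unset Strict Implicit.
Unset Printing Implicit Defensive.

Import GRing.Theory.

Local Open Scope ring_scope.
Local Open Scope quotient_scope.

Section Span.
Variables (k : fieldType) (V : lmodType k).
Implicit Types (G : V -> Prop) (u v : V).

Inductive in_span G : V -> Prop :=
| in_span0 : in_span G 0
| in_spanD (c : k) (g v : V) : G g -> in_span G v -> in_span G (c *: g + v).

Lemma in_span_add G u v : in_span G u -> in_span G v -> in_span G (u + v).
Proof.
elim=> [|c g w Gg _ IH] Gv; first by rewrite add0r.
by rewrite -addrA; apply: in_spanD => //; apply: IH.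
Qed.

Lemma in_span_scale G c v : in_span G v -> in_span G (c *: v).
Proof.
elim=> [|d g w Gg _ IH]; first by rewrite scaler0; exact: in_span0.
by rewrite scalerDr scalerA; apply: in_spanD.
Qed.

Lemma in_span_gen G g : G g -> in_span G g.
Proof.
move=> Gg; rewrite -[g]scale1r -[1 *: g]addr0.
by apply: in_spanD => //; exact: in_span0.
Qed.

Lemma in_span_sum G (I : Type) (r : seq I) (F : I -> V) :
  (forall i, in_span G (F i)) -> in_span G (\sum_(i <- r) F i).
Proof.
move=> GF; elim: r => [|i r IH]; first by rewrite big_nil; exact: in_span0.
by rewrite big_cons; apply: in_span_add.
Qed.

Definition span G : {pred V} := fun v => `[< in_span G v >].

Lemma spanP G v : reflect (in_span G v) (v \in span G).
Proof. exact: asboolP. Qed.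

Lemma span_submod_closed G : submod_closed (span G).
Proof.
split; first by apply/spanP/in_span0.
move=> c u v /spanP Gu /spanP Gv.
by apply/spanP/in_span_add => //; exact: in_span_scale.
Qed.

HB.instance Definition _ G :=
  GRing.isSubmodClosed.Build k V (span G) (span_submod_closed G).

End Span.

Lemma in_span_lin (k : fieldType) (V W : lmodType k) (f : {linear V -> W})
    (G : V -> Prop) (H : W -> Prop) v :
  (forall g, G g -> in_span H (f g)) -> in_span G v -> in_span H (f v).
Proof.
move=> GH; elim=> [|c g w Gg _ IH]; first by rewrite linear0; exact: in_span0.
rewrite linearD linearZ; apply: in_span_add => //.
by apply: in_span_scale; apply: GH.
Qed.

Definition zmod_of_submod (k : fieldType) (V : lmodType k)
  (S : submodClosed V) : {pred V} := S.

HB.instance Definition _ (k : fieldType) (V : lmodType k)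
    (S : submodClosed V) := GRing.isZmodClosed.Build V (@zmod_of_submod k V S)
    (GRing.submod_closedB (submodClosedP S)).

(* The quotient space V / S; the library only makes it a Z-module. *)
Definition lquot (k : fieldType) (V : lmodType k) (S : submodClosed V) : Type :=
  Quotient.quot (zmod_of_submod S).

Section LQuot.
Variables (k : fieldType) (V : lmodType k) (S : submodClosed V).
Local Notation Q := (lquot S).

HB.instance Definition _ := GRing.Zmodule.copy Q (Quotient.quot (zmod_of_submod S)).

Definition lpi (v : V) : Q := \pi_(Quotient.quot (zmod_of_submod S)) v.
Definition lrepr (q : Q) : V := repr (q : Quotient.quot (zmod_of_submod S)).

Lemma lreprK q : lpi (lrepr q) = q.
Proof. exact: reprK. Qed.

Lemma lpi_is_zmod_morphism : zmod_morphism lpi.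
Proof. by move=> u v; rewrite /lpi raddfB. Qed.

Lemma lpi_eq u v : (lpi u = lpi v) <-> (u - v \in S).
Proof.
rewrite /lpi (Quotient.idealrBE (zmod_of_submod S) u v).
by split=> [->|/eqP //]; rewrite eqxx.
Qed.

HB.instance Definition _ := GRing.isZmodMorphism.Build V Q lpi
  lpi_is_zmod_morphism.

Lemma lpi_eq0 v : (lpi v = 0) <-> (v \in S).
Proof. by rewrite -(raddf0 lpi) lpi_eq subr0. Qed.

Lemma lrepr_lpi v : lrepr (lpi v) - v \in S.
Proof. by apply/lpi_eq; rewrite lreprK. Qed.

Definition lquot_scale (c : k) (q : Q) : Q := lpi (c *: lrepr q).

Lemma lquot_scaleE c v : lquot_scale c (lpi v) = lpi (c *: v).
Proof. by apply/lpi_eq; rewrite -scalerBr rpredZ // lrepr_lpi. Qed.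

Fact lquot_scaleA a b q :
  lquot_scale a (lquot_scale b q) = lquot_scale (a * b) q.
Proof. by rewrite -(lreprK q) !lquot_scaleE scalerA. Qed.

Fact lquot_scale1 : left_id 1 lquot_scale.
Proof. by move=> q; rewrite -(lreprK q) !lquot_scaleE scale1r. Qed.

Fact lquot_scaleDr : right_distributive lquot_scale +%R.
Proof.
move=> c q r; rewrite -(lreprK q) -(lreprK r) -raddfD !lquot_scaleE -raddfD.
by rewrite scalerDr.
Qed.

Fact lquot_scaleDl q : {morph lquot_scale^~ q : a b / a + b}.
Proof.
by move=> a b; rewrite -(lreprK q) !lquot_scaleE -raddfD scalerDl.
Qed.

HB.instance Definition _ := GRing.Zmodule_isLmodule.Build k Q
  lquot_scaleA lquot_scale1 lquot_scaleDr lquot_scaleDl.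

Lemma lpi_is_scalable : scalable lpi.
Proof. by move=> c v; rewrite -lquot_scaleE. Qed.

HB.instance Definition _ := GRing.isScalable.Build k V Q _ lpi lpi_is_scalable.

Section Map.
Variables (f : {linear V -> V}) (fS : forall v, v \in S -> f v \in S).

Definition lquot_map of (forall v, v \in S -> f v \in S) : Q -> Q :=
  fun q => lpi (f (lrepr q)).

Lemma lquot_mapE v : lquot_map fS (lpi v) = lpi (f v).
Proof. by apply/lpi_eq; rewrite -linearB; apply: fS; exact: lrepr_lpi. Qed.

Lemma lquot_map_is_linear : linear (lquot_map fS).
Proof.
move=> c q r; rewrite -(lreprK q) -(lreprK r) -linearP !lquot_mapE -linearP.
by rewrite linearP.
Qed.

HB.instance Definition _ := GRing.isLinear.Build k Q Q _ (lquot_map fS)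
  lquot_map_is_linear.
End Map.

End LQuot.

Arguments lpi {k V} S v.

Section LSub.
Variables (k : fieldType) (V : lmodType k) (S : submodClosed V).

Record lsub : Type := LSub { lsub_val :> V; lsub_valP : lsub_val \in S }.

HB.instance Definition _ := [isSub for lsub_val].
HB.instance Definition _ := [Choice of lsub by <:].

HB.instance Definition _ := GRing.SubChoice_isSubLmodule.Build k V (mem S) lsub
  (submodClosedP S).

Section Map.
Variables (f : {linear V -> V}) (fS : forall v, v \in S -> f v \in S).

Definition lsub_map (u : lsub) : lsub := LSub (fS (lsub_valP u)).

Lemma lsub_map_is_linear : linear lsub_map.
Proof. by move=> c u v; apply: val_inj; rewrite /= !linearP. Qed.

HB.instance Definition _ := GRing.isLinear.Build k lsub lsub _ lsub_map
  lsub_map_is_linear.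
End Map.

End LSub.

Section LinComb.
Variables (k : fieldType) (X : choiceType) (V : lmodType k) (f : X -> V).

Definition lincomb (g : {malg k[X]}) : V := \sum_(x <- msupp g) g@_x *: f x.

Lemma lincombEw (d : {fset X}) g : (msupp g `<=` d)%fset ->
  lincomb g = \sum_(x <- d) g@_x *: f x.
Proof.
move=> le_gd; rewrite /lincomb; apply: big_fset_incl => // x _ /mcoeff_outdom ->.
by rewrite scale0r.
Qed.

Lemma lincomb_is_linear : linear lincomb.
Proof.
move=> c g h; pose d := (msupp g `|` msupp h)%fset.
have sg : (msupp g `<=` d)%fset by rewrite fsubsetUl.
have sh : (msupp h `<=` d)%fset by rewrite fsubsetUr.
have sgh : (msupp (c *: g + h) `<=` d)%fset.
  apply: fsubset_trans (msuppD_le _ _) _; rewrite fsubUset sh andbT.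
  exact: fsubset_trans (msuppZ_le _ _) sg.
rewrite (lincombEw sgh) (lincombEw sg) (lincombEw sh) scaler_sumr -big_split /=.
by apply: eq_bigr => x _; rewrite mcoeffD mcoeffZ scalerDl scalerA.
Qed.

HB.instance Definition _ := GRing.isLinear.Build k {malg k[X]} V _ lincomb
  lincomb_is_linear.

Lemma lincombU c x : lincomb << c *g x >> = c *: f x.
Proof.
by rewrite (lincombEw msuppU_le) big_seq_fset1 mcoeffUU.
Qed.

End LinComb.

Section MSum.
Variable V : zmodType.
Implicit Types c d : {malg V[int]}.

Definition msum c : V := \sum_(j <- msupp c) c@_j.

Lemma msumEw (s : {fset int}) c : (msupp c `<=` s)%fset ->
  msum c = \sum_(j <- s) c@_j.
Proof.
by move=> le_cs; apply: big_fset_incl => // x _ /mcoeff_outdom.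
Qed.

Lemma msum_is_zmod_morphism : zmod_morphism msum.
Proof.
move=> c d; pose s := (msupp c `|` msupp d)%fset.
have sc : (msupp c `<=` s)%fset by rewrite fsubsetUl.
have sd : (msupp d `<=` s)%fset by rewrite fsubsetUr.
have scd : (msupp (c - d) `<=` s)%fset by exact: msuppB_le.
rewrite (msumEw scd) (msumEw sc) (msumEw sd) -sumrB.
by apply: eq_bigr => j _; rewrite mcoeffB.
Qed.

HB.instance Definition _ := GRing.isZmodMorphism.Build {malg V[int]} V msum
  msum_is_zmod_morphism.

Lemma msumU j v : msum << v *g j >> = v.
Proof. by rewrite (msumEw msuppU_le) big_seq_fset1 mcoeffUU. Qed.

Lemma msum_mk (s : {fset int}) (F : int -> V) :
  msum [malg j in s => F j] = \sum_(j <- s) F j.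
Proof.
rewrite (@msumEw s); first by apply: eq_big_seq => j js; rewrite mcoeffE js.
apply/fsubsetP => j; rewrite -mcoeff_neq0 mcoeffE.
by case: ifP => // _; rewrite eqxx.
Qed.

End MSum.

Section Grading.
Variables (k : fieldType) (V : lmodType k).
Implicit Types (comp : int -> V -> Prop).

Definition homogeneous comp (v : V) : Prop := exists j, comp j v.

(* [V] is the direct sum of its subspaces [comp j]; a finitely supported family
   of vectors indexed by degrees is encoded as an element of {malg V[int]}. *)
Definition grading comp : Prop :=
  [/\ forall j, comp j 0,
      forall j (c : k) u v, comp j u -> comp j v -> comp j (c *: u + v),
      forall v, in_span (homogeneous comp) v
    & forall c : {malg V[int]}, (forall j, comp j c@_j) ->
        \sum_(j <- msupp c) c@_j = 0 -> c = 0].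

(* [S] is spanned by the homogeneous elements it contains. *)
Definition graded_sub comp (S : {pred V}) : Prop :=
  forall v, v \in S -> in_span (fun w => w \in S /\ homogeneous comp w) v.

Lemma grading_add comp j u v : grading comp ->
  comp j u -> comp j v -> comp j (u + v).
Proof. by case=> _ compP _ _ cu cv; rewrite -[u]scale1r; exact: compP. Qed.

Lemma grading_scale comp j c v : grading comp -> comp j v -> comp j (c *: v).
Proof. by case=> comp0 compP _ _ cv; rewrite -[_ *: _]addr0; exact: compP. Qed.

Lemma grading_sub_comp comp j u v : grading comp ->
  comp j u -> comp j v -> comp j (u - v).
Proof.
move=> gr cu cv; apply: grading_add => //; rewrite -scaleN1r.
exact: grading_scale.
Qed.

Lemma graded_sub_decomp comp (S : submodClosed V) v :
  grading comp -> in_span (fun w => w \in S /\ homogeneous comp w) v ->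
  exists c : {malg V[int]},
    [/\ forall j, comp j c@_j, forall j, c@_j \in S & msum c = v].
Proof.
move=> gr; elim=> [|a g w [Sg [i cg]] _ [c [cc cS cw]]].
  exists 0; split=> [j|j|]; rewrite ?mcoeff0 ?rpred0 ?raddf0 //.
  by case: gr.
exists (<< a *: g *g i >> + c); split=> [j|j|].
- rewrite mcoeffD mcoeffU; apply: grading_add => //.
  case: eqP => [<-|_]; first by rewrite mulr1n; exact: grading_scale.
  by rewrite mulr0n; case: gr.
- rewrite mcoeffD rpredD // mcoeffU; case: eqP => _; rewrite ?rpred0 //.
  by rewrite mulr1n rpredZ.
- by rewrite raddfD /= msumU cw.
Qed.

Lemma graded_sub_comps comp (S : submodClosed V) (c : {malg V[int]}) :
  grading comp -> graded_sub comp S -> (forall j, comp j c@_j) ->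
  msum c \in S -> forall j, c@_j \in S.
Proof.
move=> gr grS cc /grS /(graded_sub_decomp gr) [e [ec eS ew]] j.
suff -> : c = e by [].
apply/eqP; rewrite -subr_eq0; apply/eqP.
case: (gr) => _ _ _ indep; apply: indep => [i|].
  by rewrite mcoeffB; exact: grading_sub_comp.
by rewrite -/(msum _) raddfB /= ew subrr.
Qed.

Lemma graded_sub_span comp (G : V -> Prop) :
  (forall g, G g -> in_span (fun w => in_span G w /\ homogeneous comp w) g) ->
  graded_sub comp (span G).
Proof.
move=> GP v /spanP; elim=> [|c g w Gg _ IH]; first exact: in_span0.
apply: in_span_add => //; apply: in_span_scale.
elim: (GP _ Gg) => [|d x y [Gx hx] _ IHx]; first exact: in_span0.
by apply: in_spanD => //; split => //; apply/spanP.
Qed.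

End Grading.

Section SubQuotGrading.
Variables (k : fieldType) (V : lmodType k).
Variables (comp : int -> V -> Prop) (S : submodClosed V).
Hypotheses (gr : grading comp) (grS : graded_sub comp S).

Definition quot_comp (j : int) (q : lquot S) : Prop :=
  exists2 v, comp j v & lpi S v = q.

Lemma quot_grading : grading quot_comp.
Proof.
split=> [j|j c u v [x cx <-] [y cy <-]|q|c cc c0].
- by exists 0; [case: gr | rewrite raddf0].
- by exists (c *: x + y); [case: gr => _ H _ _; exact: H | rewrite linearP].
- rewrite -(lreprK q); case: gr => _ _ /(_ (lrepr q)) sp _.
  apply: (in_span_lin (f := lpi S)) sp => g [j cg].
  by apply: in_span_gen; exists j, g.
have /choice [v vP] : forall j, exists x, comp j x /\ lpi S x = c@_j.
  by move=> j; have [x cx xE] := cc j; exists x.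
pose d := [malg j in msupp c => v j].
have dj j : d@_j = if j \in msupp c then v j else 0 by rewrite mcoeffE.
have dc j : comp j d@_j.
  by rewrite dj; case: ifP => _; [case: (vP j) | case: gr].
have dS : msum d \in S.
  apply/lpi_eq0; rewrite msum_mk raddf_sum /= -[RHS]c0.
  by apply: eq_bigr => j _; case: (vP j).
apply/malgP => j; rewrite mcoeff0; have := graded_sub_comps gr grS dc dS j.
rewrite dj; case: ifP => [_ /lpi_eq0 <-|jc _]; first by case: (vP j).
by apply: mcoeff_outdom; rewrite jc.
Qed.

Definition sub_comp (j : int) (u : lsub S) : Prop := comp j (val u).

Lemma sub_grading : grading sub_comp.
Proof.
split=> [j|j c u v|u|c cc c0].
- by rewrite /sub_comp raddf0; case: gr.
- by rewrite /sub_comp linearP; case: gr => _ H _ _; exact: H.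
- have [c [cc cS cu]] := graded_sub_decomp gr (grS (valP u)).
  have -> : u = \sum_(j <- msupp c) LSub (cS j).
    by apply: val_inj; rewrite raddf_sum /= -cu.
  by apply: in_span_sum => j; apply: in_span_gen; exists j; exact: cc.
pose d := [malg j in msupp c => val c@_j].
have d0 : d = 0.
  case: gr => g0 _ _ indep; apply: indep => [j|].
    by rewrite mcoeffE; case: ifP => _; [exact: cc | exact: g0].
  rewrite -/(msum _) msum_mk.
  by move/(congr1 val): c0; rewrite raddf_sum.
apply/malgP => j; apply: val_inj; rewrite mcoeff0 /=.
have := congr1 (mcoeff j) d0; rewrite mcoeffE mcoeff0.
by case: ifP => // /negbT /mcoeff_outdom ->.
Qed.

End SubQuotGrading.

(* A Z-graded Lie algebra given by a basis of homogeneous elements and its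
   structure constants. *)
Record gradedLie (k : fieldType) := GradedLie {
  lie_basis :> choiceType;
  lie_br : lie_basis -> lie_basis -> {malg k[lie_basis]};
  lie_deg : lie_basis -> int;
  lie_brxx : forall x, lie_br x x = 0;
  lie_brC : forall x y, lie_br y x = - lie_br x y;
  lie_jacobi : forall x y z,
    lincomb (lie_br x) (lie_br y z) + lincomb (lie_br y) (lie_br z x)
      + lincomb (lie_br z) (lie_br x y) = 0;
  lie_br_deg : forall x y z, z \in msupp (lie_br x y) ->
    lie_deg z = lie_deg x + lie_deg y }.

Record grmod (k : fieldType) (L : gradedLie k) := GrMod {
  gm_sort :> lmodType k;
  gm_act : L -> {linear gm_sort -> gm_sort};
  gm_comp : int -> gm_sort -> Prop;
  gm_act_br : forall x y v,
    gm_act x (gm_act y v) - gm_act y (gm_act x v)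
      = lincomb (gm_act^~ v) (lie_br x y);
  gm_grading : grading gm_comp;
  gm_act_comp : forall x j v,
    gm_comp j v -> gm_comp (lie_deg x + j) (gm_act x v) }.

Arguments gm_act {k L} V x : rename.
Arguments gm_comp {k L} V j v : rename.

Section GradedModules.
Variables (k : fieldType) (L : gradedLie k).
Implicit Types (V W : grmod L).

Record grsubmod V := GrSubmod {
  gs_pred :> submodClosed V;
  gs_act : forall x v, v \in gs_pred -> gm_act V x v \in gs_pred;
  gs_graded : graded_sub (gm_comp V) gs_pred }.

Section SubQuot.
Variables (V : grmod L) (N : grsubmod V).

Lemma grquot_act_br x y (q : lquot N) :
  lquot_map (@gs_act V N x) (lquot_map (@gs_act V N y) q)
    - lquot_map (@gs_act V N y) (lquot_map (@gs_act V N x) q)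
  = lincomb (fun z => lquot_map (@gs_act V N z) q) (lie_br x y).
Proof.
rewrite -(lreprK q) !lquot_mapE -linearB gm_act_br linear_sum.
by apply: eq_bigr => z _; rewrite linearZ /= lquot_mapE.
Qed.

Lemma grquot_act_comp x j (q : lquot N) :
  quot_comp (gm_comp V) j q ->
  quot_comp (gm_comp V) (lie_deg x + j) (lquot_map (@gs_act V N x) q).
Proof.
case=> v cv <-; exists (gm_act V x v); first exact: gm_act_comp.
by rewrite lquot_mapE.
Qed.

Definition grquot : grmod L :=
  GrMod grquot_act_br (quot_grading (gm_grading V) (@gs_graded V N))
    grquot_act_comp.

Lemma grsub_act_br x y (u : lsub N) :
  lsub_map (@gs_act V N x) (lsub_map (@gs_act V N y) u)
    - lsub_map (@gs_act V N y) (lsub_map (@gs_act V N x) u)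
  = lincomb (fun z => lsub_map (@gs_act V N z) u) (lie_br x y).
Proof.
apply: val_inj; rewrite linearB linear_sum [LHS]gm_act_br.
by apply: eq_bigr => z _; rewrite linearZ.
Qed.

Lemma grsub_act_comp x j (u : lsub N) :
  sub_comp (gm_comp V) j u ->
  sub_comp (gm_comp V) (lie_deg x + j) (lsub_map (@gs_act V N x) u).
Proof. exact: gm_act_comp. Qed.

Definition grsub : grmod L :=
  GrMod grsub_act_br (sub_grading (gm_grading V) (@gs_graded V N))
    grsub_act_comp.

End SubQuot.

Definition irreducible V : Prop :=
  (exists v : V, v != 0) /\
  forall N : grsubmod V, (forall v, v \in N -> v = 0) \/ (forall v, v \in N).

Definition grhom V W (f : {linear V -> W}) : Prop :=
  (forall x v, f (gm_act V x v) = gm_act W x (f v)) /\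
  (forall j v, gm_comp V j v -> gm_comp W j (f v)).

Definition grisom V W : Prop :=
  exists2 f : {linear V -> W}, grhom f & bijective f.

End GradedModules.

Section Algebras.
Variables (k : fieldType) (A : algType k).

Lemma in_span_mul (F G H : A -> Prop) a b :
  (forall f g, F f -> G g -> in_span H (f * g)) ->
  in_span F a -> in_span G b -> in_span H (a * b).
Proof.
move=> FG Fa Gb; elim: Fa => [|c f a' Ff _ IHa].
  by rewrite mul0r; exact: in_span0.
rewrite mulrDl -scalerAl; apply: in_span_add => //; apply: in_span_scale.
elim: Gb => [|d g b' Gg _ IHb]; first by rewrite mulr0; exact: in_span0.
rewrite mulrDr -scalerAr; apply: in_span_add => //; apply: in_span_scale.
exact: FG.
Qed.

Section TwoSided.
Variable R : A -> Prop.

Definition two_sided_gen (t : A) : Prop :=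
  exists a r b, R r /\ t = a * r * b.

Definition two_sided : submodClosed A := span two_sided_gen.

Lemma two_sided_mull a t : t \in two_sided -> a * t \in two_sided.
Proof.
move=> /spanP Rt; apply/spanP.
apply: (@in_span_mul (eq a) two_sided_gen) Rt; last exact: in_span_gen.
move=> _ _ <- [b [r [c [Rr ->]]]]; apply: in_span_gen.
by exists (a * b), r, c; rewrite !mulrA.
Qed.

Lemma two_sided_mulr a t : t \in two_sided -> t * a \in two_sided.
Proof.
move=> /spanP Rt; apply/spanP.
apply: (@in_span_mul two_sided_gen (eq a)) Rt _; last exact: in_span_gen.
move=> _ _ [b [r [c [Rr ->]]]] <-; apply: in_span_gen.
by exists b, r, (c * a); rewrite !mulrA.
Qed.

Lemma two_sided_ker (B : lalgType k) (f : {lrmorphism A -> B}) t :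
  (forall r, R r -> f r = 0) -> t \in two_sided -> f t = 0.
Proof.
move=> fR /spanP; elim=> [|c _ v [b [r [d [Rr ->]]]] _ IH].
  exact: rmorph0.
by rewrite linearD linearZ /= IH addr0 !rmorphM /= (fR _ Rr) mulr0 mul0r scaler0.
Qed.

End TwoSided.

Section LeftIdeal.
Variable R : A -> Prop.

Definition left_ideal_gen (t : A) : Prop := exists a r, R r /\ t = a * r.

Definition left_ideal : submodClosed A := span left_ideal_gen.

Lemma left_ideal_mull a t : t \in left_ideal -> a * t \in left_ideal.
Proof.
move=> /spanP Rt; apply/spanP.
apply: (@in_span_mul (eq a) left_ideal_gen) Rt; last exact: in_span_gen.
move=> _ _ <- [b [r [Rr ->]]]; apply: in_span_gen.
by exists (a * b), r; rewrite mulrA.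
Qed.

End LeftIdeal.

Section GradedIdeals.
Variables (comp : int -> A -> Prop) (R : A -> Prop).
Hypotheses (gr : grading comp).
Hypothesis compM :
  forall i j a b, comp i a -> comp j b -> comp (i + j) (a * b).
Hypothesis Rhom : forall r, R r -> homogeneous comp r.

Lemma left_ideal_graded : graded_sub comp (left_ideal R).
Proof.
apply: graded_sub_span => _ [a [r [Rr ->]]].
have [j cr] := Rhom Rr; case: gr => _ _ /(_ a) spa _.
apply: (@in_span_mul (homogeneous comp) (eq r)) spa _; last exact: in_span_gen.
move=> b _ [i cb] <-; apply: in_span_gen; split.
  by apply: in_span_gen; exists b, r.
by exists (i + j); exact: compM.
Qed.

Lemma two_sided_graded : graded_sub comp (two_sided R).
Proof.
apply: graded_sub_span => _ [a [r [b [Rr ->]]]].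
have [j cr] := Rhom Rr; case: gr => _ _ sp _.
pose F t := exists2 c, homogeneous comp c & t = c * r.
apply: (@in_span_mul F (homogeneous comp)) (sp b).
  move=> _ d [c [i cc] ->] [l cd]; apply: in_span_gen; split.
    by apply: in_span_gen; exists c, r, d.
  by exists (i + j + l); do 2?[apply: compM => //].
apply: (@in_span_mul (homogeneous comp) (eq r)) (sp a) _; last first.
  exact: in_span_gen.
by move=> c _ hc <-; apply: in_span_gen; exists c.
Qed.

End GradedIdeals.

End Algebras.

Definition algquot (k : fieldType) (A : algType k) (I : submodClosed A)
    of (forall a t, t \in I -> a * t \in I)
     & (forall a t, t \in I -> t * a \in I) & 1 \notin I : Type :=
  lquot I.

Section AlgQuot.
Variables (k : fieldType) (A : algType k) (I : submodClosed A).
Hypotheses (Il : forall a t, t \in I -> a * t \in I).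
Hypotheses (Ir : forall a t, t \in I -> t * a \in I) (I1 : 1 \notin I).
Local Notation Q := (algquot Il Ir I1).

HB.instance Definition _ := GRing.Lmodule.copy Q (lquot I).

Definition algpi (a : A) : Q := lpi I a.
Definition algrepr (q : Q) : A := lrepr q.

Lemma algreprK q : algpi (algrepr q) = q.
Proof. exact: lreprK. Qed.

Lemma algrepr_pi t : algrepr (algpi t) - t \in I.
Proof. exact: lrepr_lpi. Qed.

Lemma algpi_is_linear : linear algpi.
Proof. exact: linearP. Qed.

HB.instance Definition _ := GRing.isLinear.Build k A Q _ algpi
  algpi_is_linear.

Definition algquot_mul (p q : Q) : Q := algpi (algrepr p * algrepr q).

Lemma algquot_mulE s t : algquot_mul (algpi s) (algpi t) = algpi (s * t).
Proof.
apply/lpi_eq; set s' := algrepr _; set t' := algrepr _.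
have -> : s' * t' - s * t = (s' - s) * t' + s * (t' - t).
  by rewrite mulrBl mulrBr addrA subrK.
by apply: rpredD; [apply: Ir | apply: Il]; exact: algrepr_pi.
Qed.

Fact algquot_mulA : associative algquot_mul.
Proof.
move=> u v w; rewrite -(algreprK u) -(algreprK v) -(algreprK w).
by rewrite !algquot_mulE mulrA.
Qed.

Fact algquot_mul1l : left_id (algpi 1) algquot_mul.
Proof. by move=> u; rewrite -(algreprK u) algquot_mulE mul1r. Qed.

Fact algquot_mul1r : right_id (algpi 1) algquot_mul.
Proof. by move=> u; rewrite -(algreprK u) algquot_mulE mulr1. Qed.

Fact algquot_mulDl : left_distributive algquot_mul +%R.
Proof.
move=> u v w; rewrite -(algreprK u) -(algreprK v) -(algreprK w).
by rewrite -linearD !algquot_mulE mulrDl linearD.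
Qed.

Fact algquot_mulDr : right_distributive algquot_mul +%R.
Proof.
move=> u v w; rewrite -(algreprK u) -(algreprK v) -(algreprK w).
by rewrite -linearD !algquot_mulE mulrDr linearD.
Qed.

Fact algquot_1_neq0 : algpi 1 != 0.
Proof. by apply/eqP => /lpi_eq0; apply/negP. Qed.

HB.instance Definition _ := GRing.Zmodule_isNzRing.Build Q
  algquot_mulA algquot_mul1l algquot_mul1r algquot_mulDl algquot_mulDr
  algquot_1_neq0.

Lemma algpiM s t : algpi (s * t) = algpi s * algpi t.
Proof. by rewrite -algquot_mulE. Qed.

Lemma algpiZ c t : algpi (c *: t) = c *: algpi t.
Proof. exact: linearZ. Qed.

Lemma algpi_is_monoid_morphism : monoid_morphism algpi.
Proof. by split=> // s t; exact: algpiM. Qed.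

Fact algquot_scalerAl (c : k) (u v : Q) : c *: (u * v) = (c *: u) * v.
Proof.
by rewrite -(algreprK u) -(algreprK v) -algpiM -!algpiZ -algpiM scalerAl.
Qed.

HB.instance Definition _ := GRing.Lmodule_isLalgebra.Build k Q algquot_scalerAl.

Fact algquot_scalerAr (c : k) (u v : Q) : c *: (u * v) = u * (c *: v).
Proof.
by rewrite -(algreprK u) -(algreprK v) -algpiM -!algpiZ -algpiM scalerAr.
Qed.

HB.instance Definition _ := GRing.Lalgebra_isAlgebra.Build k Q algquot_scalerAr.

HB.instance Definition _ := GRing.isMonoidMorphism.Build A Q algpi
  algpi_is_monoid_morphism.

End AlgQuot.

Section FreeAlgebra.
Variables (k : fieldType) (X : choiceType).

(* Words do not commute; the alias carries the [algType] instance, which the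
   library provides for commutative monomials only. *)
Definition freealg : Type := {malg k[{fmonom X}]}.

HB.instance Definition _ := GRing.Lalgebra.on freealg.

Definition freeword (m : {fmonom X}) : freealg := << m >>.

Lemma freewordM m n : freeword m * freeword n = freeword (mmul m n).
Proof. by rewrite [LHS]malgM_def fgmulUU mulr1. Qed.

Fact freealg_scalerAr (c : k) (s t : freealg) : c *: (s * t) = s * (c *: t).
Proof.
have comm_c (u : {malg k[{fmonom X}]}) : c%:MP * u = u * c%:MP.
  rewrite !malgM_def fgmulUg fgmulgU; apply: eq_bigr => m _.
  by rewrite mulrC mul1m mulm1.
have scale_c (u : freealg) : c *: u = (c%:MP : {malg k[{fmonom X}]}) * u.
  by rewrite mul_malgC.
rewrite (scale_c (s * t)) (scale_c t).
by rewrite (mulrA _ s t) (comm_c s) -(mulrA s _ t).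
Qed.

HB.instance Definition _ := GRing.Lalgebra_isAlgebra.Build k freealg
  freealg_scalerAr.
End FreeAlgebra.

Lemma malgU_scale (k : fieldType) (K : choiceType) (c : k) (x : K) :
  << c *g x >> = c *: << x >> :> {malg k[K]}.
Proof. by apply/malgP => y; rewrite mcoeffZ !mcoeffU mulrnAr mulr1. Qed.

Lemma linear_mul_span (k : fieldType) (A B : algType k) (f : {linear A -> B})
    (G : A -> Prop) :
  (forall a, in_span G a) ->
  (forall a b, G a -> G b -> f (a * b) = f a * f b) ->
  {morph f : a b / a * b}.
Proof.
move=> Gsp fM a b; elim: (Gsp a) => [|c a' u Ga _ IHa].
  by rewrite mul0r linear0 mul0r.
rewrite mulrDl -scalerAl !linearD !linearZ IHa mulrDl -scalerAl.
congr (_ *: _ + _); elim: (Gsp b) => [|d b' v Gb _ IHb].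
  by rewrite mulr0 linear0 mulr0.
rewrite mulrDr -scalerAr !linearD !linearZ IHb mulrDr -scalerAr.
by rewrite [f (a' * b')]fM.
Qed.

Section BracketDefect.
Variables (k : fieldType) (L : gradedLie k) (A : algType k) (g : L -> A).

Definition bracket_defect (x y : L) : A :=
  g x * g y - g y * g x - lincomb g (lie_br x y).

Lemma bracket_defect_morph (B : algType k) (f : {lrmorphism A -> B})
    (h : L -> B) x y :
  (forall z, f (g z) = h z) ->
  f (bracket_defect x y) =
    h x * h y - h y * h x - lincomb h (lie_br x y).
Proof.
move=> fg; rewrite /bracket_defect !linearB !rmorphM /= !fg linear_sum.
by congr (_ - _); apply: eq_bigr => z _; rewrite linearZ /= fg.
Qed.

End BracketDefect.

Section FreeEval.
Variables (k : fieldType) (X : choiceType) (B : algType k) (f : X -> B).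
Local Notation T := (freealg k X).
Implicit Types (s t : T).

Lemma freealg_span t : in_span (fun s => exists m, s = freeword k m) t.
Proof.
rewrite [t]monalgE; apply: in_span_sum => m; rewrite malgU_scale.
by apply: in_span_scale; apply: in_span_gen; exists m.
Qed.

Definition free_eval (t : T) : B :=
  lincomb (fun m : {fmonom X} => \prod_(x <- (m : seq X)) f x) t.

Lemma free_eval_is_linear : linear free_eval.
Proof. exact: linearP. Qed.

HB.instance Definition _ := GRing.isLinear.Build k T B _ free_eval
  free_eval_is_linear.

Lemma free_evalP c s t :
  free_eval (c *: s + t) = c *: free_eval s + free_eval t.
Proof. exact: linearP. Qed.

Lemma free_eval_word m : free_eval (freeword k m) = \prod_(x <- (m : seq X)) f x.
Proof. by rewrite /free_eval lincombU scale1r. Qed.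

Lemma free_eval_is_monoid_morphism : monoid_morphism free_eval.
Proof.
split; first by rewrite [LHS]free_eval_word fm1 big_nil.
apply: (linear_mul_span freealg_span) => _ _ [m ->] [n ->].
by rewrite freewordM /= !free_eval_word fmM big_cat.
Qed.

HB.instance Definition _ := GRing.isMonoidMorphism.Build T B free_eval
  free_eval_is_monoid_morphism.

End FreeEval.

Section EnvelopingAlgebra.
Variables (k : fieldType) (L : gradedLie k).
Local Notation T := (freealg k L).
Implicit Types (s t : T) (x y : L) (m : {fmonom L}).

Definition free_gen x : T := freeword k (fmu x).

Lemma free_eval_gen (B : algType k) (f : L -> B) x :
  free_eval f (free_gen x) = f x.
Proof. by rewrite free_eval_word fmU big_seq1. Qed.

Definition env_relator t : Prop := exists x y, t = bracket_defect free_gen x y.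

Definition env_ideal : submodClosed T := two_sided env_relator.

Lemma env_ideal_proper : 1 \notin env_ideal.
Proof.
apply/negP => I1; pose f (x : L) : k^o := 0.
suff /eqP : free_eval f 1 = 0 by rewrite rmorph1 oner_eq0.
apply: two_sided_ker I1 => _ [x [y ->]].
rewrite (bracket_defect_morph _ _ (free_eval_gen f)) mulr0 subrr sub0r.
by apply/eqP; rewrite oppr_eq0; apply/eqP/big1 => z _; rewrite scaler0.
Qed.

Definition envalg : algType k :=
  algquot (@two_sided_mull k T env_relator)
    (@two_sided_mulr k T env_relator) env_ideal_proper.
Local Notation U := envalg.

Definition env_pi : {lrmorphism T -> U} := algpi _ _ _.

Definition env_gen x : U := env_pi (free_gen x).

Lemma env_pi_surj (u : U) : exists t, env_pi t = u.
Proof. by exists (algrepr u); exact: algreprK. Qed.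

Lemma env_bracket x y :
  env_gen x * env_gen y - env_gen y * env_gen x
    = lincomb env_gen (lie_br x y).
Proof.
apply/eqP; rewrite -subr_eq0; apply/eqP.
rewrite -(bracket_defect_morph (f := env_pi) x y (fun=> erefl)).
apply/lpi_eq0/spanP/in_span_gen.
by exists 1, (bracket_defect free_gen x y), 1; rewrite mul1r mulr1; split=> //;
  exists x, y.
Qed.

Definition word_deg m : int := \sum_(x <- (m : seq L)) lie_deg x.

Definition free_comp (j : int) : T -> Prop :=
  in_span (fun t => exists2 m, word_deg m = j & t = freeword k m).

Lemma free_compM i j s t :
  free_comp i s -> free_comp j t -> free_comp (i + j) (s * t).
Proof.
apply: in_span_mul => _ _ [m mi ->] [n nj ->].
apply: in_span_gen; exists (mmul m n); last exact: freewordM.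
by rewrite /word_deg fmM big_cat -mi -nj.
Qed.

Lemma free_comp_gen x : free_comp (lie_deg x) (free_gen x).
Proof.
apply: in_span_gen; exists (fmu x) => //.
by rewrite /word_deg fmU big_seq1.
Qed.

Lemma free_comp_coef j (t : {malg k[{fmonom L}]}) m :
  free_comp j t -> word_deg m != j -> t@_m = 0.
Proof.
move=> cj mj; elim: cj => [|c _ t' [n nj ->] _ IH]; first exact: mcoeff0.
rewrite [LHS]mcoeffD [X in _ + X]IH addr0 [LHS]mcoeffZ.
rewrite /freeword mcoeffU1; case: eqP => [nm|]; last by rewrite mulr0.
by rewrite -nm nj eqxx in mj.
Qed.

Lemma free_grading : grading free_comp.
Proof.
split=> [j|j c u v cu cv|t|c cc c0].
- exact: in_span0.
- by apply: in_span_add => //; exact: in_span_scale.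
- elim: (freealg_span t) => [|c _ t' [m ->] _ IH]; first exact: in_span0.
  by apply: in_spanD => //; exists (word_deg m); apply: in_span_gen; exists m.
apply/malgP => j; rewrite mcoeff0; apply/malgP => m; rewrite mcoeff0.
have [mj|] := eqVneq (word_deg m) j; last exact: free_comp_coef.
have [jc|jc] := boolP (j \in msupp c); last first.
  by rewrite (mcoeff_outdom jc) mcoeff0.
move/(congr1 (mcoeff m)): c0; rewrite mcoeff0 raddf_sum /=.
rewrite (big_fsetD1 j) //= big1_fset ?addr0 // => i.
rewrite !inE => /andP[ij _] _; apply: (@free_comp_coef i) => //.
by rewrite mj eq_sym.
Qed.

Lemma env_relator_homogeneous t : env_relator t -> homogeneous free_comp t.
Proof.
case=> x [y ->]; exists (lie_deg x + lie_deg y).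
apply: grading_sub_comp free_grading _ _.
  apply: grading_sub_comp free_grading _ _.
    by apply: free_compM; exact: free_comp_gen.
  by rewrite addrC; apply: free_compM; exact: free_comp_gen.
rewrite /lincomb big_seq; elim/big_ind: _ => [|u v|z zs].
- exact: in_span0.
- exact: in_span_add.
- by apply: in_span_scale; rewrite -(lie_br_deg zs); exact: free_comp_gen.
Qed.

Lemma env_ideal_graded : graded_sub free_comp env_ideal.
Proof.
exact: two_sided_graded free_grading free_compM env_relator_homogeneous.
Qed.

Definition env_comp : int -> U -> Prop := quot_comp (S := env_ideal) free_comp.

Lemma env_grading : grading env_comp.
Proof. exact: quot_grading free_grading env_ideal_graded. Qed.

Lemma env_compM i j (u v : U) :
  env_comp i u -> env_comp j v -> env_comp (i + j) (u * v).
Proof.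
case=> s cs <- [t ct <-]; exists (s * t); first exact: free_compM.
exact: (rmorphM env_pi).
Qed.

Lemma env_comp_gen x : env_comp (lie_deg x) (env_gen x).
Proof. by exists (free_gen x) => //; exact: free_comp_gen. Qed.

Lemma env_comp_span (u : U) :
  in_span (fun v => exists m, v = env_pi (freeword k m)) u.
Proof.
have [t <-] := env_pi_surj u; apply: in_span_lin (freealg_span t) => _ [m ->].
by apply: in_span_gen; exists m.
Qed.

Section Lift.
Variables (B : algType k) (f : L -> B).

Definition env_compatible : Prop :=
  forall x y, f x * f y - f y * f x = lincomb f (lie_br x y).

Hypothesis fP : env_compatible.

Definition env_lift of env_compatible : U -> B :=
  fun u => free_eval f (algrepr u).

Lemma env_lift_pi t : env_lift fP (env_pi t) = free_eval f t.
Proof.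
apply/eqP; rewrite -subr_eq0 -linearB; apply/eqP.
apply: (two_sided_ker (R := env_relator)); last exact: algrepr_pi.
move=> _ [x [y ->]]; rewrite (bracket_defect_morph _ _ (free_eval_gen f)) fP.
exact: subrr.
Qed.

Lemma env_lift_gen x : env_lift fP (env_gen x) = f x.
Proof. by rewrite env_lift_pi free_eval_gen. Qed.

Lemma env_lift_is_linear : linear (env_lift fP).
Proof.
move=> c u v; have [s <-] := env_pi_surj u; have [t <-] := env_pi_surj v.
by rewrite -linearP !env_lift_pi linearP.
Qed.

HB.instance Definition _ := GRing.isLinear.Build k U B _ (env_lift fP)
  env_lift_is_linear.

Lemma env_lift_is_monoid_morphism : monoid_morphism (env_lift fP).
Proof.
split=> [|u v]; first by rewrite -(rmorph1 env_pi) env_lift_pi rmorph1.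
have [s <-] := env_pi_surj u; have [t <-] := env_pi_surj v.
by rewrite -rmorphM !env_lift_pi rmorphM.
Qed.

HB.instance Definition _ := GRing.isMonoidMorphism.Build U B (env_lift fP)
  env_lift_is_monoid_morphism.

End Lift.

Section Induced.
Variable P : {pred L}.

Definition ind_gen (u : U) : Prop := exists2 x, x \in P & u = env_gen x.

Definition ind_ideal : submodClosed U := left_ideal ind_gen.

Lemma ind_ideal_graded : graded_sub env_comp ind_ideal.
Proof.
apply: left_ideal_graded env_grading env_compM _ => _ [x _ ->].
by exists (lie_deg x); exact: env_comp_gen.
Qed.

Definition env_lmul x (u : U) : U := env_gen x * u.

Lemma env_lmul_is_linear x : linear (env_lmul x).
Proof. by move=> c u v; rewrite /env_lmul mulrDr scalerAr. Qed.

HB.instance Definition _ x := GRing.isLinear.Build k U U _ (env_lmul x)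
  (env_lmul_is_linear x).

Lemma ind_ideal_act x u : u \in ind_ideal -> env_lmul x u \in ind_ideal.
Proof. exact: left_ideal_mull. Qed.

Lemma ind_act_br x y (q : lquot ind_ideal) :
  lquot_map (@ind_ideal_act x) (lquot_map (@ind_ideal_act y) q)
    - lquot_map (@ind_ideal_act y) (lquot_map (@ind_ideal_act x) q)
  = lincomb (fun z => lquot_map (@ind_ideal_act z) q) (lie_br x y).
Proof.
rewrite -(lreprK q) !lquot_mapE -linearB /= /env_lmul !mulrA -mulrBl.
rewrite env_bracket mulr_suml linear_sum; apply: eq_bigr => z _.
by rewrite -scalerAl linearZ /= lquot_mapE.
Qed.

Lemma ind_act_comp x j (q : lquot ind_ideal) :
  quot_comp env_comp j q ->
  quot_comp env_comp (lie_deg x + j) (lquot_map (@ind_ideal_act x) q).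
Proof.
case=> u cu <-; exists (env_gen x * u); last by rewrite lquot_mapE.
by apply: env_compM => //; exact: env_comp_gen.
Qed.

(* When the basis elements in P span a Lie subalgebra p of L, this is
   Ind_p^L(k u0) = U(L) (x)_{U(p)} k u0 = U(L) / U(L) p, where p u0 = 0 and
   u0, the class of 1, has degree 0. *)
Definition induced : grmod L :=
  GrMod ind_act_br (quot_grading env_grading ind_ideal_graded) ind_act_comp.

End Induced.

End EnvelopingAlgebra.

Inductive sl2_basis := sl2_e | sl2_f | sl2_h.

Definition sl2_basis_code (x : sl2_basis) : option bool :=
  match x with sl2_e => Some true | sl2_f => Some false | sl2_h => None end.

Definition sl2_basis_decode (b : option bool) : sl2_basis :=
  match b with Some true => sl2_e | Some false => sl2_f | None => sl2_h end.

Lemma sl2_basis_codeK : cancel sl2_basis_code sl2_basis_decode.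
Proof. by case. Qed.

HB.instance Definition _ := Choice.copy sl2_basis (can_type sl2_basis_codeK).

Section SL2.
Variable k : fieldType.

Definition sl2_table (V : lmodType k) (e f h : V) (x y : sl2_basis) : V :=
  match x, y with
  | sl2_e, sl2_f => h
  | sl2_f, sl2_e => - h
  | sl2_h, sl2_e => 2%:R *: e
  | sl2_e, sl2_h => - (2%:R *: e)
  | sl2_h, sl2_f => - (2%:R *: f)
  | sl2_f, sl2_h => 2%:R *: f
  | _, _ => 0
  end.

Definition sl2_br : sl2_basis -> sl2_basis -> {malg k[sl2_basis]} :=
  sl2_table << sl2_e >> << sl2_f >> << sl2_h >>.

Lemma sl2_table_jacobi (V : lmodType k) (e f h : V)
    (B : sl2_basis -> {linear V -> V}) x y z :
  (forall w, [/\ B w e = sl2_table e f h w sl2_e,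
      B w f = sl2_table e f h w sl2_f & B w h = sl2_table e f h w sl2_h]) ->
  B x (sl2_table e f h y z) + B y (sl2_table e f h z x)
    + B z (sl2_table e f h x y) = 0.
Proof.
move=> BP; have Be w : B w e = sl2_table e f h w sl2_e by case: (BP w).
have Bf w : B w f = sl2_table e f h w sl2_f by case: (BP w).
have Bh w : B w h = sl2_table e f h w sl2_h by case: (BP w).
by case: x; case: y; case: z;
  rewrite /= ?linearN ?linearZ ?linear0 /= ?Be ?Bf ?Bh /=;
  rewrite ?(scaler0, oppr0, addr0, add0r, scalerN, opprK, subrr, addNr).
Qed.

Fact sl2_brxx x : sl2_br x x = 0. Proof. by case: x. Qed.

Fact sl2_brC x y : sl2_br y x = - sl2_br x y.
Proof. by case: x; case: y; rewrite /= ?oppr0 ?opprK. Qed.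

Fact sl2_jacobi x y z :
  lincomb (sl2_br x) (sl2_br y z) + lincomb (sl2_br y) (sl2_br z x)
    + lincomb (sl2_br z) (sl2_br x y) = 0.
Proof.
apply: (sl2_table_jacobi (B := fun w => lincomb (sl2_br w))) => w.
by split; rewrite /= lincombU scale1r.
Qed.

Fact sl2_br_deg x y z : z \in msupp (sl2_br x y) -> 0 = 0 + 0 :> int.
Proof. by rewrite addr0. Qed.

Definition sl2 : gradedLie k :=
  @GradedLie k sl2_basis sl2_br (fun=> 0) sl2_brxx sl2_brC sl2_jacobi
    sl2_br_deg.

End SL2.

Lemma linear_add3 (k : fieldType) (V W : lmodType k) (f : {linear V -> W})
    (u v w : V) : f u + f v + f w = f (u + v + w).
Proof. by rewrite !linearD. Qed.

Section Loop.
Variables (k : fieldType) (L : gradedLie k).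
Local Notation X := (L * int)%type.

Definition loop_tensor (j : int) (g : {malg k[L]}) : {malg k[X]} :=
  lincomb (fun x => << (x, j) >>) g.

Definition loop_br (x y : X) : {malg k[X]} :=
  loop_tensor (x.2 + y.2) (lie_br x.1 y.1).

HB.instance Definition _ j := GRing.Linear.copy (loop_tensor j)
  (lincomb (fun x : L => << (x, j) >> : {malg k[X]})).

Fact loop_brxx x : loop_br x x = 0.
Proof. by rewrite /loop_br lie_brxx /loop_tensor linear0. Qed.

Fact loop_brC x y : loop_br y x = - loop_br x y.
Proof. by rewrite /loop_br lie_brC /loop_tensor linearN addrC. Qed.

Lemma loop_br_tensor x j g :
  lincomb (loop_br x) (loop_tensor j g) =
    loop_tensor (x.2 + j) (lincomb (lie_br x.1) g).
Proof.
rewrite {1}/loop_tensor /loop_tensor [lincomb _ g]/lincomb.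
rewrite [lincomb (lie_br _) g]/lincomb !linear_sum.
by apply: eq_bigr => y _; rewrite !linearZ /= lincombU scale1r.
Qed.

Fact loop_jacobi x y z :
  lincomb (loop_br x) (loop_br y z) + lincomb (loop_br y) (loop_br z x)
    + lincomb (loop_br z) (loop_br x y) = 0.
Proof.
have E n u v w : u.2 + (v.2 + w.2) = n -> lincomb (loop_br u) (loop_br v w)
    = loop_tensor n (lincomb (lie_br u.1) (lie_br v.1 w.1)).
  by move=> <-; exact: loop_br_tensor.
have rot (i j l : int) : j + (l + i) = i + (j + l) by rewrite addrA addrC.
pose n := x.2 + (y.2 + z.2).
have Ex := E n x y z erefl.
have Ey := E n y z x (rot x.2 y.2 z.2).
have Ez := E n z x y (etrans (rot y.2 z.2 x.2) (rot x.2 y.2 z.2)).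
apply: etrans (congr2 +%R (congr2 +%R Ex Ey) Ez) _.
apply: etrans (linear_add3 _ _ _ _) _.
by apply: etrans (congr1 _ (lie_jacobi _ _ _)) _; exact: linear0.
Qed.

Fact loop_br_deg x y z : z \in msupp (loop_br x y) -> z.2 = x.2 + y.2.
Proof.
rewrite -mcoeff_neq0 => /eqP cz; apply/eqP; apply/negP => /negP zxy.
apply: cz; rewrite raddf_sum big1 // => t _ /=.
rewrite mcoeffZ mcoeffU; case: eqP => [tz|]; last by rewrite mulr0.
by rewrite -tz eqxx in zxy.
Qed.

(* The basis element (x, j) is x (x) t^j; the grading is by the degree in t
   and ignores the grading of L. *)
Definition loop : gradedLie k :=
  GradedLie loop_brxx loop_brC loop_jacobi loop_br_deg.

End Loop.

Section Cartan.
Variable k : fieldType.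

Definition abelian_br (i j : int) : {malg k[int]} := 0.

Fact abelian_brC i j : abelian_br j i = - abelian_br i j.
Proof. by rewrite oppr0. Qed.

Fact abelian_jacobi i j l :
  lincomb (abelian_br i) (abelian_br j l)
    + lincomb (abelian_br j) (abelian_br l i)
    + lincomb (abelian_br l) (abelian_br i j) = 0.
Proof. by rewrite !linear0 !addr0. Qed.

Fact abelian_br_deg i j l : l \in msupp (abelian_br i j) -> l = i + j.
Proof. by rewrite msupp0 in_fset0. Qed.

(* The abelian Lie algebra H of the loop algebra of sl(2); the basis element
   [j : int] stands for h(j), as made explicit by [res_cartan] below. *)
Definition cartan : gradedLie k :=
  @GradedLie k int abelian_br id (fun=> erefl) abelian_brC abelian_jacobi
    abelian_br_deg.

End Cartan.

Section WeightSpace.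
Variables (k : fieldType) (V : grmod (cartan k)).

Lemma eigen_graded (f : {linear V -> V}) (c : k)
    (S : {pred V}) :
  (forall j v, gm_comp V j v -> gm_comp V j (f v)) ->
  (forall v, (v \in S) = (f v == c *: v)) ->
  graded_sub (gm_comp V) S.
Proof.
move=> fc SE v; have gr := gm_grading V; case: (gr) => g0 gP sp indep.
have [d [dc _ <-]] : exists d : {malg V[int]},
    [/\ forall j, gm_comp V j d@_j, forall j, d@_j \in span (fun=> True)
      & msum d = v].
  apply: (graded_sub_decomp (S := span (fun=> True)) gr).
  elim: (sp v) => [|a g w hg _ IH]; first exact: in_span0.
  apply: in_spanD => //; split => //; apply/spanP.
  exact: in_span_gen.
rewrite SE => /eqP fd.
have dS j : d@_j \in S.
  pose e := [malg i in msupp d => f d@_i - c *: d@_i].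
  have e0 : e = 0.
    apply: indep => [i|].
      rewrite mcoeffE; case: ifP => // _.
      by apply: grading_sub_comp => //; [exact: fc | exact: grading_scale].
    rewrite -/(msum e) msum_mk sumrB -scaler_sumr -linear_sum -/(msum d) fd.
    exact: subrr.
  rewrite SE -subr_eq0; apply/eqP; have := congr1 (mcoeff j) e0.
  rewrite mcoeffE mcoeff0; case: ifP => // /negbT /mcoeff_outdom -> _.
  by rewrite linear0 scaler0 subrr.
apply: in_span_sum => j; apply: in_span_gen; split => //.
by exists j; exact: dc.
Qed.

Variable c : k.

Definition weight_pred : {pred V} := fun v => gm_act V 0 v == c *: v.

Lemma weight_submod_closed : submod_closed weight_pred.
Proof.
split=> [|a u v /eqP uP /eqP vP]; apply/eqP; first by rewrite linear0 scaler0.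
by rewrite linearD linearZ /= uP vP scalerDr !scalerA mulrC.
Qed.

HB.instance Definition _ := GRing.isSubmodClosed.Build k V
  weight_pred weight_submod_closed.

Lemma weight_act (j : cartan k) (v : V) :
  v \in weight_pred -> gm_act V j v \in weight_pred.
Proof.
move=> /eqP vP; apply/eqP; have := gm_act_br (0 : cartan k) j v.
rewrite linear0 => /eqP; rewrite subr_eq0 => /eqP ->.
by rewrite vP linearZ.
Qed.

Lemma weight_graded : graded_sub (gm_comp V) weight_pred.
Proof.
apply: (@eigen_graded (gm_act V 0) c) => // j v cv.
by have := gm_act_comp (0 : cartan k) cv; rewrite add0r.
Qed.

Definition weight_submod : grsubmod V :=
  GrSubmod (gs_pred := weight_pred) weight_act weight_graded.

End WeightSpace.

Section Layers.
Variable k : fieldType.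

Definition loop_sl2 : gradedLie k := loop (sl2 k).

Section Restriction.
Variable V : grmod loop_sl2.

Lemma res_act_br (i j : cartan k) (v : V) :
  gm_act V (sl2_h, i) (gm_act V (sl2_h, j) v)
    - gm_act V (sl2_h, j) (gm_act V (sl2_h, i) v)
  = lincomb (fun l : cartan k => gm_act V (sl2_h, l) v) (lie_br i j).
Proof.
by rewrite gm_act_br /= /loop_br /= /loop_tensor !linear0.
Qed.

Lemma res_act_comp (i : cartan k) j (v : V) :
  gm_comp V j v -> gm_comp V (lie_deg i + j) (gm_act V (sl2_h, i) v).
Proof. exact: (@gm_act_comp _ loop_sl2 V (sl2_h, i)). Qed.

Definition res_cartan : grmod (cartan k) :=
  GrMod res_act_br (gm_grading V) res_act_comp.

End Restriction.

(* [x.1 != sl2_f] selects the basis of the subalgebra H (+) E. *)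
Definition M0 : grmod loop_sl2 :=
  induced [pred x : loop_sl2 | x.1 != sl2_f].

(* The eigenspace of h(0) for -2n, as a graded module over H. *)
Definition layer (n : nat) : grmod (cartan k) :=
  grsub (weight_submod (res_cartan M0) (- (2 * n)%:R)).

End Layers.

Section GradedMul.
Variables (k : fieldType) (V : lmodType k) (mul : V -> V -> V) (e : int -> V).
Hypothesis mulDl : left_distributive mul +%R.
Hypothesis mulDr : forall p, {morph mul p : q r / q + r}.
Hypothesis mulZl : forall c p q, mul (c *: p) q = c *: mul p q.
Hypothesis mulZr : forall c p q, mul p (c *: q) = c *: mul p q.
Hypothesis mulX : forall i j, mul (e i) (e j) = e (i + j).
Hypothesis espan : forall p, in_span (fun q => exists j, q = e j) p.

Lemma graded_mul_ind (P : V -> Prop) :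
  P 0 -> (forall c j p, P p -> P (c *: e j + p)) -> forall p, P p.
Proof.
move=> P0 PD p; elim: (espan p) => [|c _ q [j ->] _]; first exact: P0.
exact: PD.
Qed.

Let mul0l p : mul 0 p = 0.
Proof. by have := mulZl 0 0 p; rewrite !scale0r. Qed.

Let mul0r p : mul p 0 = 0.
Proof. by have := mulZr 0 p 0; rewrite !scale0r. Qed.

Lemma graded_mulC : commutative mul.
Proof.
move=> p q; elim/graded_mul_ind: p => [|c i p IH]; first by rewrite mul0l mul0r.
rewrite mulDl mulDr IH mulZl mulZr; congr (_ *: _ + _).
elim/graded_mul_ind: q {IH} => [|d j q IH]; first by rewrite mul0l mul0r.
by rewrite mulDl mulDr IH mulZl mulZr !mulX (addrC i j).
Qed.

Lemma graded_mulA : associative mul.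
Proof.
move=> p q r; elim/graded_mul_ind: p => [|c i p IH]; first by rewrite !mul0l.
rewrite !(mulDl, mulZl) IH; congr (_ *: _ + _).
elim/graded_mul_ind: q {IH} => [|d j q IH]; first by rewrite !(mul0l, mul0r).
rewrite !(mulDl, mulDr, mulZl, mulZr) IH; congr (_ *: _ + _).
elim/graded_mul_ind: r {IH} => [|a l r IH]; first by rewrite !mul0r.
by rewrite !(mulDr, mulZr) IH !mulX addrA.
Qed.

Lemma graded_mul1l : left_id (e 0) mul.
Proof.
move=> p; elim/graded_mul_ind: p => [|c j p IH]; first exact: mul0r.
by rewrite mulDr IH mulZr mulX add0r.
Qed.

End GradedMul.

(* k[t^+-1]; [int] is not a [monomType], so {malg k[int]} has no library
   product. *)
Definition laurent (k : fieldType) : Type := {malg k[int]}.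

Section Laurent.
Variable k : fieldType.
Local Notation Lk := (laurent k).
Implicit Types (p q r : Lk).

HB.instance Definition _ := GRing.Lmodule.on Lk.

Definition texp (j : int) : Lk := << j >>.

Definition laurent_mul p q : Lk :=
  lincomb (fun i => lincomb (fun j => texp (i + j)) q) p.

Lemma laurent_span p : in_span (fun q => exists j, q = texp j) p.
Proof.
rewrite [p]monalgE; apply: in_span_sum => j; rewrite malgU_scale.
by apply: in_span_scale; apply: in_span_gen; exists j.
Qed.

Lemma laurent_mulDl : left_distributive laurent_mul +%R.
Proof. by move=> p q r; rewrite /laurent_mul linearD. Qed.

Lemma laurent_mulZl c p q : laurent_mul (c *: p) q = c *: laurent_mul p q.
Proof. by rewrite /laurent_mul linearZ. Qed.

Lemma laurent_mulX i j : laurent_mul (texp i) (texp j) = texp (i + j).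
Proof. by rewrite /laurent_mul !lincombU !scale1r. Qed.

Lemma laurent_mulDr p : {morph laurent_mul p : q r / q + r}.
Proof.
move=> q r; rewrite /laurent_mul /lincomb -big_split /=; apply: eq_bigr => i _.
by rewrite -scalerDr -/(lincomb _ _) linearD.
Qed.

Lemma laurent_mulZr c p q : laurent_mul p (c *: q) = c *: laurent_mul p q.
Proof.
rewrite /laurent_mul [in RHS]/lincomb scaler_sumr; apply: eq_bigr => i _.
by rewrite linearZ /= !scalerA mulrC.
Qed.

Fact laurent_mulC : commutative laurent_mul.
Proof.
exact: (graded_mulC laurent_mulDl laurent_mulDr laurent_mulZl laurent_mulZr
  laurent_mulX laurent_span).
Qed.

Fact laurent_mulA : associative laurent_mul.
Proof.
exact: (graded_mulA laurent_mulDl laurent_mulDr laurent_mulZl laurent_mulZr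
  laurent_mulX laurent_span).
Qed.

Fact laurent_mul1l : left_id (texp 0) laurent_mul.
Proof.
exact: (graded_mul1l laurent_mulDr laurent_mulZr laurent_mulX laurent_span).
Qed.

Fact laurent_1_neq0 : texp 0 != 0.
Proof.
apply/eqP => /(congr1 (mcoeff (0 : int))); rewrite mcoeffUU mcoeff0.
by apply/eqP; exact: oner_neq0.
Qed.

HB.instance Definition _ := GRing.Zmodule_isComNzRing.Build Lk
  laurent_mulA laurent_mulC laurent_mul1l laurent_mulDl laurent_1_neq0.

Fact laurent_scalerAl (c : k) p q : c *: (p * q) = (c *: p) * q.
Proof. by rewrite -[RHS]/(laurent_mul _ _) laurent_mulZl. Qed.

HB.instance Definition _ := GRing.Lmodule_isLalgebra.Build k Lk laurent_scalerAl.
HB.instance Definition _ := GRing.Lalgebra_isComAlgebra.Build k Lk.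

Lemma texpD i j : texp (i + j) = texp i * texp j.
Proof. exact/esym/laurent_mulX. Qed.

Definition laurent_comp (j : int) p : Prop := exists c, p = c *: texp j.

Lemma laurent_compM i j p q :
  laurent_comp i p -> laurent_comp j q -> laurent_comp (i + j) (p * q).
Proof.
move=> [c ->] [d ->]; exists (c * d).
by rewrite texpD -scalerAl -scalerAr scalerA.
Qed.

Lemma laurent_grading : grading laurent_comp.
Proof.
split=> [j|j a _ _ [c ->] [d ->]|p|c cc c0].
- by exists 0; rewrite scale0r.
- by exists (a * c + d); rewrite scalerDl scalerA.
- elim: (laurent_span p) => [|c _ q [j ->] _ IH]; first exact: in_span0.
  by apply: in_spanD => //; exists j, 1; rewrite scale1r.
have coef i j : i != j -> (c@_i : {malg k[int]})@_j = 0.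
  move=> ij; have [a ->] := cc i; rewrite [LHS]mcoeffZ mcoeffU.
  by rewrite (negbTE ij) mulr0.
apply/malgP => j; rewrite mcoeff0; apply/malgP => i; rewrite mcoeff0.
have [ji|] := eqVneq j i; last exact: coef.
have [jc|jc] := boolP (j \in msupp c); last first.
  by rewrite (mcoeff_outdom jc) mcoeff0.
move/(congr1 (mcoeff i)): c0; rewrite mcoeff0 raddf_sum /=.
rewrite (big_fsetD1 j) //= big1_fset ?addr0 // => l.
by rewrite !inE => /andP[lj _] _; apply: coef; rewrite -ji.
Qed.

End Laurent.

Section W.
Variables (k : fieldType) (phi : int -> k).
Local Notation U := (envalg (cartan k)).

Definition phi_gen (j : cartan k) : laurent k := phi j *: texp k j.

Lemma phi_gen_compatible : env_compatible phi_gen.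
Proof. by move=> i j; rewrite mulrC subrr linear0. Qed.

Definition phi_tilde : {lrmorphism U -> laurent k} :=
  env_lift phi_gen_compatible.

Lemma phi_tilde_gen j : phi_tilde (env_gen j) = phi j *: texp k j.
Proof. exact: env_lift_gen. Qed.

Definition phi_act (j : int) (p : laurent k) : laurent k := phi_gen j * p.

Lemma phi_act_is_linear j : linear (phi_act j).
Proof. by move=> c p q; rewrite /phi_act mulrDr scalerAr. Qed.

HB.instance Definition _ j := GRing.isLinear.Build k (laurent k) (laurent k) _
  (phi_act j) (phi_act_is_linear j).

Lemma phi_act_br (i j : cartan k) (p : laurent k) :
  phi_act i (phi_act j p) - phi_act j (phi_act i p)
    = lincomb (fun l : cartan k => phi_act l p) (lie_br i j).
Proof. by rewrite /phi_act mulrCA subrr linear0. Qed.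

Lemma phi_gen_comp (j : cartan k) : laurent_comp j (phi_gen j).
Proof. by exists (phi j). Qed.

Lemma phi_act_comp (i : cartan k) j (p : laurent k) :
  laurent_comp j p -> laurent_comp (lie_deg i + j) (phi_act i p).
Proof. by apply: laurent_compM; exact: phi_gen_comp. Qed.

(* k[t^+-1] as a module over H via [phi_tilde]: h(j) acts as phi(j) t^j. *)
Definition laurent_mod : grmod (cartan k) :=
  GrMod phi_act_br (laurent_grading k) phi_act_comp.

Definition W_pred : {pred laurent_mod} :=
  fun p => `[< exists u, phi_tilde u = p >].

Lemma W_submod_closed : submod_closed W_pred.
Proof.
split=> [|c p q /asboolP[u <-] /asboolP[v <-]]; apply/asboolP.
  by exists 0; rewrite linear0.
by exists (c *: u + v); rewrite linearP.
Qed.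

HB.instance Definition _ := GRing.isSubmodClosed.Build k laurent_mod W_pred
  W_submod_closed.

Lemma W_act (j : cartan k) (p : laurent_mod) :
  p \in W_pred -> gm_act laurent_mod j p \in W_pred.
Proof.
move=> /asboolP[u <-]; apply/asboolP; exists (env_gen j * u).
by rewrite rmorphM /= phi_tilde_gen.
Qed.

Lemma W_graded : graded_sub (gm_comp laurent_mod) W_pred.
Proof.
move=> _ /asboolP[u <-]; apply: in_span_lin (env_comp_span u) => _ [m ->].
apply: in_span_gen; split; first by apply/asboolP; exists (env_pi _ (freeword k m)).
exists (word_deg m); rewrite /= [phi_tilde _]env_lift_pi free_eval_word /word_deg.
elim: (m : seq _) => [|j s IH].
  by rewrite !big_nil; exists 1; rewrite scale1r.
by rewrite !big_cons; apply: laurent_compM => //; exact: phi_gen_comp.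
Qed.

Definition W_submod : grsubmod laurent_mod :=
  GrSubmod (gs_pred := W_pred) W_act W_graded.

Definition W : grmod (cartan k) := grsub W_submod.

End W.

Definition in_Exp (k : fieldType) (n : nat) (phi : int -> k) : Prop :=
  exists alpha : 'I_n -> k, (forall i, alpha i != 0) /\
    forall j : int, phi j = - 2%:R * \sum_(i < n) alpha i ^ j.

(* Main.v *)
(* The layer M_n is the space of S_n-coinvariants of k[t_1^+-1, ..., t_n^+-1],
   f(chi_1) ... f(chi_n) u0 being the class of t^chi, and h(j) acts as
   multiplication by -2 (t_1^j + ... + t_n^j).  In characteristic zero power sums
   generate the symmetric Laurent polynomials, so M_n is cyclic over U(H).

   A point alpha of the torus gives a functional on M_n, the symmetrized
   evaluation at alpha; it is obtained from the product of the Verma modules of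
   weight 0 evaluated at the alpha_i.  Graded by the degree, this functional is a
   homomorphism of M_n onto W(phi), with phi(j) = -2 sum_i alpha_i^j, and W(phi)
   is irreducible: if phi(j) <> 0, then phi(-jm) <> 0 for some m > 0, so that
   each t^j in W(phi) is invertible in W(phi).

   Conversely, let N be a graded submodule of M_n with irreducible quotient.  The
   Laurent polynomials all of whose multiples have their class in N form a proper
   ideal, which has a zero alpha by the Nullstellensatz.  As every element of N is
   the class of a symmetric polynomial lying in this ideal, the functional of
   alpha vanishes on N, and N is the kernel of M_n -> W(phi) by maximality. *)
From HB Require Import structures.
Require Import Defs.
From mathcomp Require Import all_boot all_order all_algebra.
From mathcomp Require Import finmap generic_quotient ring_quotient.
From mathcomp.classical Require Import boolp.
From mathcomp.multinomials Require Import monalg.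

Set Implicit Arguments.
Unset Strict Implicit.
Unset Printing Implicit Defensive.

Import GRing.Theory.

Local Open Scope ring_scope.
Local Open Scope quotient_scope.

(** * Induced modules *)

Section InducedUniversal.
Variables (k : fieldType) (L : gradedLie k) (V : lmodType k).
Variable rho : L -> {linear V -> V}.
Hypothesis rho_br : forall x y v,
  rho x (rho y v) - rho y (rho x v) = lincomb (rho^~ v) (lie_br x y).
Local Notation T := (freealg k L).
Local Notation U := (envalg L).

Definition word_act (v : V) (m : {fmonom L}) : V :=
  foldr (fun x w => rho x w) v (m : seq L).

Definition free_act (v : V) (t : T) : V := lincomb (word_act v) t.

Lemma free_act_is_linear v : linear (free_act v).
Proof. exact: linearP. Qed.

HB.instance Definition _ v :=
  GRing.isLinear.Build k T V _ (free_act v) (free_act_is_linear v).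

Lemma free_actP v c s t :
  free_act v (c *: s + t) = c *: free_act v s + free_act v t.
Proof. exact: linearP. Qed.

Lemma free_actB v s t : free_act v (s - t) = free_act v s - free_act v t.
Proof. exact: linearB. Qed.

Lemma free_act_word v m : free_act v (freeword k m) = word_act v m.
Proof. by rewrite /free_act lincombU scale1r. Qed.

Lemma word_actP m : linear (word_act^~ m).
Proof.
move=> c u v; rewrite /word_act; elim: (m : seq L) => //= x r ->.
exact: linearP.
Qed.

Lemma word_act0 m : word_act 0 m = 0.
Proof.
by have := word_actP m (-1) 0 0; rewrite scaler0 addr0 scaleN1r addNr.
Qed.

Lemma free_actM v s t : free_act v (s * t) = free_act (free_act v t) s.
Proof.
elim: (freealg_span s) => [|c _ s' [m ->] _ IH];
  first by rewrite mul0r !linear0.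
rewrite mulrDl -scalerAl (free_actP v) (free_actP _ c).
congr (_ *: _ + _); last exact: IH.
rewrite free_act_word.
elim: (freealg_span t) => [|d _ t' [n ->] _ {}IH].
  by rewrite mulr0 !linear0 word_act0.
rewrite mulrDr -scalerAr (free_actP v) (free_actP v) word_actP.
congr (_ *: _ + _); last exact: IH.
rewrite freewordM !free_act_word.
by rewrite /word_act fmM foldr_cat.
Qed.

Lemma free_act_gen v x : free_act v (free_gen x) = rho x v.
Proof. by rewrite free_act_word /word_act fmU. Qed.

Lemma free_act_lincomb v (b : {malg k[L]}) :
  free_act v (lincomb (@free_gen k L) b) = lincomb (rho^~ v) b.
Proof.
rewrite {1}/lincomb linear_sum; apply: eq_bigr => z _.
by rewrite linearZ /= free_act_gen.
Qed.

Lemma free_act0 t : free_act 0 t = 0.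
Proof.
elim: (freealg_span t) => [|c _ t' [m ->] _ IH]; first exact: linear0.
by rewrite free_actP IH free_act_word word_act0 addr0 scaler0.
Qed.

(** By [rho_br] a relator acts by zero on every vector, hence so does any product containing it as a
    factor. Thus the action of words descends to the enveloping algebra. *)
Lemma free_act_ideal v t : t \in env_ideal L -> free_act v t = 0.
Proof.
move=> /spanP; elim=> [|c _ w [a [_ [b [[x [y ->]] ->]]]] _ IH].
  exact: linear0.
rewrite free_actP IH addr0 !free_actM; set v' := free_act v b.
suff -> : free_act v' (bracket_defect (@free_gen k L) x y) = 0.
  by rewrite free_act0 scaler0.
have E z z' : free_act v' (free_gen z * free_gen z') = rho z (rho z' v').
  apply: etrans (free_actM _ _ _) (etrans (free_act_gen _ _) _).
  by rewrite free_act_gen.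
rewrite /bracket_defect (free_actB v') (free_actB v') free_act_lincomb -rho_br.
by apply/eqP; rewrite subr_eq0; apply/eqP; congr (_ - _); exact: E.
Qed.

Definition env_act (v : V) (u : U) : V := free_act v (algrepr u).

Lemma env_act_pi v t : env_act v (env_pi L t) = free_act v t.
Proof.
apply/eqP; rewrite -subr_eq0 -linearB; apply/eqP.
by apply: free_act_ideal; exact: algrepr_pi.
Qed.

Lemma env_act_is_linear v : linear (env_act v).
Proof.
move=> c a b; have [s <-] := env_pi_surj a; have [t <-] := env_pi_surj b.
by rewrite -linearP !env_act_pi linearP.
Qed.

HB.instance Definition _ v :=
  GRing.isLinear.Build k U V _ (env_act v) (env_act_is_linear v).

Lemma env_actM v a b : env_act v (a * b) = env_act (env_act v b) a.
Proof.
have [s <-] := env_pi_surj a; have [t <-] := env_pi_surj b.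
by rewrite -rmorphM !env_act_pi free_actM.
Qed.

Lemma env_act_gen v x : env_act v (env_gen x) = rho x v.
Proof. by rewrite env_act_pi free_act_gen. Qed.

Lemma env_act0 a : env_act 0 a = 0.
Proof. exact: free_act0. Qed.

Variables (P : {pred L}) (v0 : V).
Hypothesis v0P : forall x, x \in P -> rho x v0 = 0.

Lemma env_act_ideal u : u \in ind_ideal P -> env_act v0 u = 0.
Proof.
move=> /spanP; elim=> [|c _ w [a [_ [[x xP ->] ->]]] _ IH];
  first exact: linear0.
by rewrite linearP /= IH env_actM env_act_gen v0P // env_act0 scaler0 addr0.
Qed.

(** The map given by the universal property of the induced module, sending the class of 1 to [v0].
    Its target is a bare vector space with operators, since the polynomial modules it is used for
    are given without a grading. *)
Definition ind_lift (q : induced P) : V := env_act v0 (lrepr q).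

Lemma ind_lift_pi u : ind_lift (lpi (ind_ideal P) u) = env_act v0 u.
Proof.
apply/eqP; rewrite -subr_eq0 -linearB; apply/eqP.
by apply: env_act_ideal; exact: lrepr_lpi.
Qed.

Lemma ind_lift_is_linear : linear ind_lift.
Proof.
move=> c p q; rewrite -(lreprK p) -(lreprK q).
by rewrite -[_ + _](linearP (lpi _)) !ind_lift_pi linearP.
Qed.

Lemma ind_lift_act x q : ind_lift (gm_act (induced P) x q) = rho x (ind_lift q).
Proof.
rewrite -(lreprK q) /= lquot_mapE !ind_lift_pi /env_lmul env_actM.
exact: env_act_gen.
Qed.

Lemma ind_lift1 : ind_lift (lpi (ind_ideal P) 1) = v0.
Proof.
rewrite ind_lift_pi -(rmorph1 (env_pi L)) env_act_pi [free_act _ _]free_act_word.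
by rewrite /word_act fm1.
Qed.

End InducedUniversal.

Section InducedGen.
Variables (k : fieldType) (L : gradedLie k) (P : {pred L}).
Local Notation V := (induced P).

Definition ind_one : V := lpi (ind_ideal P) 1.

(** The class of 1 generates: every vector is a combination of words in the basis of [L] applied to
    it. Generation is passed on in this form as the hypothesis [V_ind]. *)
Lemma induced_ind (S : V -> Prop) :
  S 0 -> (forall c u v, S u -> S v -> S (c *: u + v)) ->
  (forall x v, S v -> S (gm_act V x v)) -> S ind_one -> forall v, S v.
Proof.
move=> S0 SP Sact S1 v; rewrite -(lreprK v).
elim: (env_comp_span (lrepr v)) => [|c _ u [m ->] _ IH];
  first by rewrite linear0.
rewrite linearP; apply: SP => //.
case: m => s; elim: s => [|x s IHs].
  by rewrite -fmoneE (_ : freeword k _ = 1) // rmorph1.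
have -> : freeword k (FMonom (x :: s)) = free_gen x * freeword k (FMonom s).
  by rewrite freewordM; congr freeword; apply: val_inj; rewrite /= fmM fmU.
by have := Sact x _ IHs; rewrite /= lquot_mapE /= /env_lmul rmorphM.
Qed.

Lemma ind_one_act x : x \in P -> gm_act V x ind_one = 0.
Proof.
move=> xP; rewrite /= lquot_mapE; apply/lpi_eq0/spanP/in_span_gen.
by exists 1, (env_gen x); split; [exists x | rewrite /= /env_lmul mulr1 mul1r].
Qed.

Lemma ind_one_comp : gm_comp V 0 ind_one.
Proof.
exists 1 => //; exists 1; last exact: (rmorph1 (env_pi L)).
apply: in_span_gen; exists (mone : {fmonom L}) => //.
by rewrite /word_deg fm1 big_nil.
Qed.

End InducedGen.

(** * Graded modules and homomorphisms *)

Section Decomposition.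
Variables (k : fieldType) (V : lmodType k) (comp : int -> V -> Prop).
Hypothesis gr : grading comp.

Lemma grading_decomp v :
  exists c : {malg V[int]}, (forall j, comp j c@_j) /\ msum c = v.
Proof.
have [c [cc _ cv]] : exists c : {malg V[int]},
    [/\ forall j, comp j c@_j, forall j, c@_j \in Defs.span (fun=> True) & msum c = v].
  apply: (graded_sub_decomp (S := Defs.span (fun=> True)) gr).
  case: gr => _ _ /(_ v) + _; elim=> [|a g w hg _ IH]; first exact: in_span0.
  by apply: in_spanD => //; split => //; apply/spanP; exact: in_span_gen.
by exists c.
Qed.

Lemma grading_uniq (c d : {malg V[int]}) :
  (forall j, comp j c@_j) -> (forall j, comp j d@_j) -> msum c = msum d -> c = d.
Proof.
move=> cc dc cd; apply/eqP; rewrite -subr_eq0; apply/eqP.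
case: (gr) => _ _ _; apply=> [j|].
  by rewrite mcoeffB; exact: grading_sub_comp.
by rewrite -/(msum _) raddfB /= cd subrr.
Qed.

Definition gdec (v : V) : {malg V[int]} := sval (cid (grading_decomp v)).

Lemma gdec_comp v j : comp j (gdec v)@_j.
Proof. by rewrite /gdec; case: cid => c []. Qed.

Lemma msum_gdec v : msum (gdec v) = v.
Proof. by rewrite /gdec; case: cid => c []. Qed.

Lemma gdec_eq (c : {malg V[int]}) v :
  (forall j, comp j c@_j) -> msum c = v -> gdec v = c.
Proof.
move=> cc cv; apply: grading_uniq cc _; first exact: gdec_comp.
by rewrite msum_gdec.
Qed.

Lemma gdecP c u v j : (gdec (c *: u + v))@_j = c *: (gdec u)@_j + (gdec v)@_j.
Proof.
pose s := (msupp (gdec u) `|` msupp (gdec v))%fset.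
pose F i := c *: (gdec u)@_i + (gdec v)@_i.
have FE i : [malg i in s => F i]@_i = F i.
  rewrite mcoeffE; case: ifP => // /negbT; rewrite in_fsetU negb_or /F.
  by case/andP => /mcoeff_outdom -> /mcoeff_outdom ->; rewrite scaler0 addr0.
rewrite (@gdec_eq [malg i in s => F i]) ?FE // => [i|].
  by rewrite FE; case: (gr) => _ H _ _; apply: H; exact: gdec_comp.
rewrite msum_mk big_split /= -scaler_sumr -!msumEw ?fsubsetUl ?fsubsetUr //.
by rewrite !msum_gdec.
Qed.

Lemma gdec_homog j v : comp j v -> gdec v = << v *g j >>.
Proof.
move=> cv; apply: gdec_eq => [i|]; last exact: msumU.
by rewrite mcoeffU; case: eqP => [<-|_]; rewrite ?mulr1n // mulr0n; case: gr.
Qed.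

Lemma homog_neq j v i : comp j v -> i != j -> (gdec v)@_i = 0.
Proof. by move=> /gdec_homog -> ij; rewrite mcoeffU eq_sym (negbTE ij). Qed.

Lemma graded_sub_gdec (S : submodClosed V) v : graded_sub comp S ->
  v \in S -> forall j, (gdec v)@_j \in S.
Proof.
move=> grS vS; apply: (graded_sub_comps gr grS); first exact: gdec_comp.
by rewrite msum_gdec.
Qed.

Lemma gdec_span (S : submodClosed V) v : (forall j, (gdec v)@_j \in S) ->
  in_span (fun w => w \in S /\ homogeneous comp w) v.
Proof.
move=> dS; rewrite -(msum_gdec v); apply: in_span_sum => j; apply: in_span_gen.
by split=> //; exists j; exact: gdec_comp.
Qed.

End Decomposition.

(** * Preimages, images and isomorphisms of graded modules *)

Section GradedHom.
Variables (k : fieldType) (L : gradedLie k).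
Implicit Types (V W : grmod L).

Lemma grhom_gdec V W (f : {linear V -> W}) v j : grhom f ->
  (gdec (gm_grading W) (f v))@_j = f (gdec (gm_grading V) v)@_j.
Proof.
case=> _ fc; pose c := gdec (gm_grading V) v.
have FE i : [malg i in msupp c => f c@_i]@_i = f c@_i.
  by rewrite mcoeffE; case: ifP => // /negbT/mcoeff_outdom ->; rewrite linear0.
rewrite (@gdec_eq _ _ _ _ [malg i in msupp c => f c@_i]) ?FE // => [i|].
  by rewrite FE; apply: fc; exact: gdec_comp.
by rewrite msum_mk -linear_sum -/(msum c) msum_gdec.
Qed.

Section Comap.
Variables (V W : grmod L) (f : {linear V -> W}) (fh : grhom f) (N : grsubmod W).

Definition comap_pred of grhom f : {pred V} := fun v => f v \in N.

Lemma comap_predE v : (v \in comap_pred fh) = (f v \in N).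
Proof. by []. Qed.

Lemma comap_submod_closed : submod_closed (comap_pred fh).
Proof.
split=> [|c u v]; rewrite !comap_predE; first by rewrite linear0 rpred0.
by rewrite linearP => uN vN; rewrite rpredD // rpredZ.
Qed.

HB.instance Definition _ := GRing.isSubmodClosed.Build k V
  (comap_pred fh) comap_submod_closed.

Lemma comap_act x v : v \in comap_pred fh -> gm_act V x v \in comap_pred fh.
Proof. by rewrite !comap_predE fh.1; exact: gs_act. Qed.

Lemma comap_graded : graded_sub (gm_comp V) (comap_pred fh).
Proof.
move=> v vN; apply: (gdec_span (gr := gm_grading V)) => j.
rewrite comap_predE -(grhom_gdec _ _ fh); apply: graded_sub_gdec => //.
exact: gs_graded.
Qed.

Definition comap_submod : grsubmod V :=
  GrSubmod (gs_pred := comap_pred fh) comap_act comap_graded.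

End Comap.

Section Image.
Variables (V W : grmod L) (f : {linear V -> W}) (fh : grhom f) (N : grsubmod V).

Definition image_pred of grhom f : {pred W} :=
  fun w => `[< exists2 v, v \in N & f v = w >].

Lemma image_submod_closed : submod_closed (image_pred fh).
Proof.
split=> [|c u v /asboolP[x xN <-] /asboolP[y yN <-]]; apply/asboolP.
  by exists 0; rewrite ?rpred0 ?linear0.
by exists (c *: x + y); rewrite ?linearP // rpredD // rpredZ.
Qed.

HB.instance Definition _ := GRing.isSubmodClosed.Build k W
  (image_pred fh) image_submod_closed.

Lemma image_act x w : w \in image_pred fh -> gm_act W x w \in image_pred fh.
Proof.
move=> /asboolP[v vN <-]; apply/asboolP; exists (gm_act V x v);
  last exact: fh.1.
exact: gs_act.
Qed.

Lemma image_graded : graded_sub (gm_comp W) (image_pred fh).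
Proof.
move=> _ /asboolP[v vN <-]; apply: in_span_lin (gs_graded vN) => g [gN [j gj]].
apply: in_span_gen; split; first by apply/asboolP; exists g.
by exists j; exact: fh.2.
Qed.

Definition image_submod : grsubmod W :=
  GrSubmod (gs_pred := image_pred fh) image_act image_graded.

End Image.

Section Zero.
Variable V : grmod L.

Definition zero_pred : {pred V} := fun v => v == 0.

Lemma zero_submod_closed : submod_closed zero_pred.
Proof.
split=> [|c u v /eqP -> /eqP ->]; first exact: eqxx.
by rewrite unfold_in scaler0 addr0.
Qed.

HB.instance Definition _ := GRing.isSubmodClosed.Build k V
  zero_pred zero_submod_closed.

Lemma zero_act x v : v \in zero_pred -> gm_act V x v \in zero_pred.
Proof. by move=> /eqP ->; rewrite unfold_in linear0. Qed.

Lemma zero_graded : graded_sub (gm_comp V) zero_pred.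
Proof. by move=> _ /eqP ->; exact: in_span0. Qed.

Definition zero_submod : grsubmod V :=
  GrSubmod (gs_pred := zero_pred) zero_act zero_graded.

End Zero.

Definition ker_submod V W (f : {linear V -> W}) (fh : grhom f) : grsubmod V :=
  comap_submod fh (zero_submod W).

Lemma ker_submodE V W (f : {linear V -> W}) (fh : grhom f) v :
  v \in ker_submod fh <-> f v = 0.
Proof. by split=> /eqP. Qed.

Lemma inj_surj_bij (A B : Type) (f : A -> B) :
  injective f -> (forall b, exists a, f a = b) -> bijective f.
Proof.
move=> fi /choice[g fg]; exists g => // a; apply: fi; exact: fg.
Qed.

(** For [w] homogeneous, [f] maps the components of [g w] to those of [w]. As [f] is injective, only
    the component in the degree of [w] survives, so the inverse respects degrees. *)
Lemma grisom_sym V W : grisom V W -> grisom W V.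
Proof.
case=> f [fact fc] [g fK gK].
have glin : linear g.
  by move=> c u v; apply: (can_inj fK); rewrite linearP /= !gK.
pose h : {linear W -> V} := HB.pack g (GRing.isLinear.Build k W V _ g glin).
exists h; last by exists f.
split=> [x v|j w wj]; first by apply: (can_inj fK); rewrite fact !gK.
pose c := gdec (gm_grading V) (g w).
have c0 i : i != j -> c@_i = 0.
  move=> ij; apply: (can_inj fK);
    rewrite linear0 -(grhom_gdec _ _ (conj fact fc)).
  by rewrite gK; apply: (homog_neq (gm_grading W) wj ij).
suff -> : h w = c@_j by exact: gdec_comp.
rewrite -[LHS](msum_gdec (gm_grading V)) -/c.
rewrite (@msumEw _ [fset j]%fset) ?big_seq_fset1 //.
apply/fsubsetP => i; rewrite -mcoeff_neq0 in_fset1 => ci.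
by apply: contraNT ci => /c0 ->.
Qed.

Lemma irreducible_isom V W : grisom V W -> irreducible V -> irreducible W.
Proof.
case=> f fh [g fK gK] [[v0 v00] irr]; split.
  by exists (f v0); apply: contra_neq v00 => f0;
    rewrite -[v0]fK f0 -(linear0 f) fK.
move=> N; case: (irr (comap_submod fh N)) => H; [left|right] => w.
  by rewrite -[w]gK => wN; rewrite (H (g w)) ?linear0.
by rewrite -[w]gK; exact: (H (g w)).
Qed.

(** First isomorphism theorem, with kernel and image characterized by their elements. *)
Lemma quot_sub_isom V W (f : {linear V -> W})
    (N : grsubmod V) (S : grsubmod W) :
  grhom f -> (forall v, v \in N <-> f v = 0) ->
  (forall w, w \in S <-> exists v, f v = w) -> grisom (grquot N) (grsub S).
Proof.
move=> fh NE SE.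
have fS v : f v \in S by apply/SE; exists v.
pose g (q : grquot N) : grsub S := LSub (fS (lrepr q)).
have gpi v : g (lpi N v) = LSub (fS v).
  apply: val_inj; rewrite -[LHS]/(f (lrepr (lpi N v))) /=; apply/eqP.
  by rewrite -subr_eq0 -linearB; apply/eqP/NE; exact: lrepr_lpi.
have glin : linear g.
  move=> c p q; rewrite -(lreprK p) -(lreprK q) -[_ + _](linearP (lpi N)) !gpi.
  by apply: val_inj; rewrite /= linearP.
pose h : {linear grquot N -> grsub S} :=
  HB.pack g (GRing.isLinear.Build k (grquot N) (grsub S) _ g glin).
have hE v : h (lpi N v) = LSub (fS v) by exact: gpi.
exists h.
  split=> [x q|j q [v vj <-]]; last by rewrite hE; exact: fh.2.
  rewrite -(lreprK q) hE [gm_act _ _ _]lquot_mapE hE; apply: val_inj.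
  exact: fh.1.
apply: inj_surj_bij => [p q|w].
  rewrite -(lreprK p) -(lreprK q) !hE => -[E].
  by apply/lpi_eq/NE; rewrite linearB E subrr.
have [v vw] := (SE _).1 (lsub_valP w); exists (lpi N v).
by rewrite hE; apply: val_inj.
Qed.

End GradedHom.

(** * The modules W(phi) *)

Lemma texp_coef (k : fieldType) (i j : int) :
  (texp k j : {malg k[int]})@_i = (j == i)%:R.
Proof. by rewrite /texp mcoeffU. Qed.

(** * From a functional to a graded homomorphism *)

Section GradedLift.
Variables (k : fieldType) (V : grmod (cartan k)) (phi : int -> k).
Variable lam : {scalar V}.
Hypothesis lam_act : forall j v, lam (gm_act V j v) = phi j * lam v.
Local Notation dec := (gdec (gm_grading V)).

(** [lam] forgets degrees; recording its value on each homogeneous component at the matching power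
    of t turns it into a graded map. *)
Definition glift (v : V) : laurent_mod phi :=
  [malg j in msupp (dec v) => lam (dec v)@_j].

Lemma glift_coef v j : (glift v : {malg k[int]})@_j = lam (dec v)@_j.
Proof.
by rewrite mcoeffE; case: ifP => // /negbT/mcoeff_outdom ->; rewrite linear0.
Qed.

Lemma glift_is_linear : linear glift.
Proof.
move=> c u v; apply/malgP => j; rewrite glift_coef gdecP linearP.
by rewrite [RHS]mcoeffD [X in _ = X + _]mcoeffZ !glift_coef.
Qed.

HB.instance Definition _ :=
  GRing.isLinear.Build k V (laurent_mod phi) _ glift glift_is_linear.

Lemma glift_homog j v : gm_comp V j v -> glift v = lam v *: texp k j.
Proof.
move=> vj; apply/malgP => i; rewrite glift_coef (gdec_homog _ vj) mcoeffU.
rewrite [RHS]mcoeffZ [X in _ * X]texp_coef; case: eqP => _;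
  first by rewrite mulr1n mulr1.
by rewrite mulr0n linear0 mulr0.
Qed.

Lemma glift_act j v :
  glift (gm_act V j v) = gm_act (laurent_mod phi) j (glift v).
Proof.
case: (gm_grading V) => _ _ /(_ v) + _; elim=> [|c g w [i gi] _ IH].
  by rewrite !linear0.
have gE : glift (gm_act V j g) = gm_act (laurent_mod phi) j (glift g).
  rewrite (glift_homog (gm_act_comp j gi)) (glift_homog gi) lam_act.
  by rewrite /= /phi_act /phi_gen texpD -scalerAl -scalerAr scalerA.
have -> : gm_act V j (c *: g + w) = c *: gm_act V j g + gm_act V j w.
  exact: linearP.
rewrite !glift_is_linear.
apply: etrans (congr2 (fun p q : laurent_mod phi => c *: p + q) gE IH) _.
exact/esym/linearP.
Qed.

Lemma glift_hom : grhom glift.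
Proof.
by split=> [|j v vj]; [exact: glift_act | exists (lam v); exact: glift_homog].
Qed.

(** A graded submodule contains the homogeneous components of its elements, and [lam] vanishes on
    each of them. *)
Lemma glift_grsub_eq0 (N : grsubmod V) v :
  (forall w, w \in N -> lam w = 0) -> v \in N -> glift v = 0.
Proof.
move=> N0 vN; apply/malgP => j; rewrite glift_coef mcoeff0 N0 //.
by apply: graded_sub_gdec => //; exact: gs_graded.
Qed.

End GradedLift.

Section CartanOperators.
Variables (k : fieldType) (V : grmod (cartan k)).

(** The operators by which U(H) acts, generated inductively so that linearity and stability of
    submodules follow by induction. *)
Inductive hop : (V -> V) -> Prop :=
| hop_id : hop id
| hop_act j T : hop T -> hop (fun v => gm_act V j (T v))
| hop_lin c T T' : hop T -> hop T' -> hop (fun v => c *: T v + T' v).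

Lemma hopP T : hop T -> linear T.
Proof.
elim=> [//|j {}T _ IH|a {}T T' _ IH _ IH'] c u v; first by rewrite IH linearP.
rewrite IH IH' !scalerDr !scalerA mulrC -!addrA; congr (_ + _).
by rewrite addrCA.
Qed.

Lemma hop_closed T (S : submodClosed V) v : hop T ->
  (forall j u, u \in S -> gm_act V j u \in S) -> v \in S -> T v \in S.
Proof.
move=> hT SV vS; elim: hT => [//|j {}T _ IH|a {}T T' _ IH _ IH'].
  exact: SV.
by rewrite rpredD // rpredZ.
Qed.

End CartanOperators.

(** If all these power sums vanished, the values at the b_i of any polynomial without constant term
    would sum to zero. But [Q] vanishes at 0 and at every b_i other than the value [b i0], so its
    values sum to [Q.[b i0]] times the multiplicity of [b i0], which is non-zero in characteristic
    zero. *)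
Lemma power_sum_neq0 (k : fieldType) (n : nat) (b : 'I_n -> k) :
  [pchar k] =i pred0 -> (0 < n)%N -> (forall i, b i != 0) ->
  exists m, \sum_i b i ^+ m.+1 != 0.
Proof.
move=> k0 n0 b0; apply/not_existsP => bs; pose i0 := Ordinal n0.
pose Q := 'X * \prod_(i | b i != b i0) ('X - (b i)%:P).
have Q0 : Q`_0 = 0 by rewrite /Q mulrC coefMX.
have Qi0 : Q.[b i0] != 0.
  rewrite hornerM hornerX mulf_neq0 // horner_prod; apply/prodf_neq0 => i ne.
  by rewrite hornerXsubC subr_eq0 eq_sym.
have Qi i : Q.[b i] = (b i == b i0)%:R * Q.[b i0].
  case: eqP => [->|/eqP ne]; first by rewrite mul1r.
  by rewrite mul0r hornerM horner_prod (bigD1 i) //= hornerXsubC subrr mul0r mulr0.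
have : \sum_i Q.[b i] = 0.
  under eq_bigr => i _ do rewrite horner_coef.
  rewrite exchange_big /= big1 // => -[[|j] jQ] _ /=.
    by rewrite big1 // => i _; rewrite Q0 mul0r.
  by rewrite -mulr_sumr; have /negP/negPn/eqP -> := bs j; rewrite mulr0.
under eq_bigr => i _ do rewrite Qi.
rewrite -mulr_suml => /eqP; rewrite mulf_eq0 (negbTE Qi0) orbF -natr_sum.
rewrite ((pcharf0P _).1 k0) sum_nat_eq0 => /forallP/(_ i0).
by rewrite eqxx.
Qed.

(** Up to the factor -2, the values phi(-jm) for m > 0 are the power sums of the non-zero numbers
    alpha_i^(-j). *)
Lemma in_Exp_opp (k : fieldType) (n : nat) (phi : int -> k) (j : int) :
  [pchar k] =i pred0 -> in_Exp n phi -> phi j != 0 ->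
  exists m, phi (- j *+ m.+1) != 0.
Proof.
move=> k0 [a [a0 phiE]] pj.
have two0 : - 2%:R != 0 :> k by rewrite oppr_eq0 ((pcharf0P _).1 k0).
have n0 : (0 < n)%N.
  rewrite lt0n; apply: contraNneq pj => n0; rewrite phiE big1 ?mulr0 // => i _.
  by exfalso; have := ltn_ord i; rewrite {2}n0.
have [|m mP] := @power_sum_neq0 k n (fun i => a i ^ (- j)) k0 n0.
  by move=> i; rewrite expfz_neq0.
exists m; rewrite phiE mulf_neq0 //; apply: contra_neq mP => E.
rewrite -[RHS]E; apply: eq_bigr => i _.
by rewrite exprnP exprz_exp -mulr_natr natz.
Qed.

(** * Irreducibility of W(phi) *)

Section WIrreducible.
Variables (k : fieldType) (phi : int -> k).
Local Notation inW p := (p \in @W_pred k phi).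

Lemma W_mul p q : inW p -> inW q -> inW (p * q).
Proof.
move=> /asboolP[u <-] /asboolP[v <-]; apply/asboolP.
by exists (u * v); rewrite rmorphM.
Qed.

Lemma W_one : inW (texp k 0).
Proof. by apply/asboolP; exists 1; exact: rmorph1. Qed.

Lemma W_texp j : phi j != 0 -> inW (texp k j).
Proof.
move=> pj; apply/asboolP; exists ((phi j)^-1 *: env_gen (j : cartan k)).
by rewrite linearZ /= phi_tilde_gen scalerA mulVf // scale1r.
Qed.

Lemma W_texpMn j m : inW (texp k j) -> inW (texp k (j *+ m)).
Proof.
move=> jW; elim: m => [|m IH]; first by rewrite mulr0n; exact: W_one.
by rewrite mulrS texpD; exact: W_mul.
Qed.

Hypothesis phi_opp : forall j, phi j != 0 -> exists m, phi (- j *+ m.+1) != 0.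

Definition W_unit (d : int) : Prop := inW (texp k d) /\ inW (texp k (- d)).

(** t^(-j) is the product of t^(-j(m+1)), which lies in W because phi is non-zero there, and of the
    m-th power of t^j. *)
Lemma W_unit_gen j : phi j != 0 -> W_unit j.
Proof.
move=> pj; split; first exact: W_texp.
have [m pm] := phi_opp pj.
have -> : - j = - j *+ m.+1 + j *+ m by rewrite mulrS mulNrn subrK.
by rewrite texpD; apply: W_mul; [exact: W_texp | exact/W_texpMn/W_texp].
Qed.

Lemma W_unitD d e : W_unit d -> W_unit e -> W_unit (d + e).
Proof.
by move=> [? ?] [? ?]; rewrite /W_unit opprD !texpD; split; exact: W_mul.
Qed.

(** A word in the h(j) is sent to the product of the phi(j) t^j: either some phi(j) is zero, or all
    the degrees involved are invertible. *)
Lemma W_span p : inW p ->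
  in_span (fun q => exists2 d, W_unit d & q = texp k d) p.
Proof.
move=> /asboolP[u <-]; apply: in_span_lin (env_comp_span u) => _ [m ->].
rewrite /= [phi_tilde _ _]env_lift_pi free_eval_word.
set G := (X in in_span X).
have G1 : in_span G (texp k 0).
  by apply: in_span_gen; exists 0; rewrite // /W_unit oppr0; split;
    exact: W_one.
elim: (m : seq _) => [|j s IH]; first by rewrite big_nil.
rewrite big_cons /phi_gen; have [->|pj] := eqVneq (phi j) 0.
  by rewrite scale0r mul0r; exact: in_span0.
apply: (@in_span_mul _ _ (eq (phi j *: texp k j)) G) IH;
  last exact: in_span_gen.
move=> _ _ <- [d dW ->]; rewrite -scalerAl -texpD; apply: in_span_scale.
by apply: in_span_gen; exists (j + d) => //; apply: W_unitD => //;
  exact: W_unit_gen.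
Qed.

Lemma W_unit_coef p d : inW p -> (p : {malg k[int]})@_d != 0 -> W_unit d.
Proof.
move=> /W_span sp pd; apply: contrapT => Nd; case/eqP: pd.
elim: sp => [|c _ q [e eW ->] _ IH]; first exact: mcoeff0.
rewrite [LHS]mcoeffD [X in _ + X]IH addr0 [LHS]mcoeffZ texp_coef.
by case: eqP => [ed|]; [case: Nd; rewrite -ed | rewrite mulr0].
Qed.

(** An element of W is a polynomial in the phi(j) t^j, so multiplying by it is acting by an element
    of U(H): submodules of W are ideals. *)
Lemma W_mul_closed (N : grsubmod (W phi)) (w : W phi) p :
  w \in N -> inW p -> exists2 w', w' \in N & val w' = p * val w.
Proof.
move=> wN /asboolP[u <-].
elim: (env_comp_span u) => [|c _ q [m ->] _ [w' w'N w'E]].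
  by exists 0; rewrite ?rpred0 // !linear0 mul0r.
have [y yN yE] : exists2 y, y \in N
    & val y = phi_tilde phi (env_pi _ (freeword k m)) * val w.
  rewrite /= [phi_tilde _ _]env_lift_pi free_eval_word.
  elim: (m : seq _) => [|j s [y yN yE]].
    by exists w => //; rewrite big_nil mul1r.
  exists (gm_act (W phi) j y); first exact: gs_act.
  rewrite big_cons -mulrA;
    exact: (congr1 (fun q : laurent k => phi_gen phi j * q) yE).
exists (c *: y + w'); first by rewrite rpredD // rpredZ.
by rewrite linearP /= w'E [in LHS]yE linearP mulrDl -scalerAl.
Qed.

(** A non-zero graded submodule contains some a t^j with a non-zero; since t^(-j) lies in W, it
    contains 1, which generates W. *)
Lemma W_irreducible : irreducible (W phi).
Proof.
pose one : W phi := LSub W_one.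
split.
  exists one; apply/eqP => /(congr1 val)/(congr1 (mcoeff (0 : int))).
  by rewrite /= texp_coef [RHS]mcoeff0 => /eqP; rewrite oner_eq0.
move=> N; have [[v vN v0]|nov] := pselect (exists2 v, v \in N & v != 0);
  last first.
  by left=> v vN; have [//|v0] := eqVneq v 0; case: nov; exists v.
right; have oneN : one \in N.
  pose c := gdec (gm_grading (W phi)) v.
  have [j cj] : exists j, c@_j != 0.
    apply/not_existsP => c0; case/eqP: v0.
    rewrite -(msum_gdec (gm_grading (W phi)) v) /msum big1 // => j _.
    by have /negP/negPn/eqP := c0 j.
  have cN : c@_j \in N by apply: graded_sub_gdec => //; exact: gs_graded.
  have [a aE] : laurent_comp j (val c@_j) := gdec_comp (gm_grading (W phi)) v j.
  have a0 : a != 0.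
    by apply: contra_neq cj => a0; apply: val_inj; rewrite aE a0 scale0r.
  have [_ jW] : W_unit j.
    apply: (W_unit_coef (lsub_valP c@_j)); rewrite [lsub_val _]aE.
    by rewrite [X in X != _]mcoeffZ texp_coef eqxx mulr1.
  have [w wN wE] := W_mul_closed cN jW.
  suff -> : one = a^-1 *: w by rewrite rpredZ.
  apply: val_inj; rewrite linearZ /= [lsub_val w]wE aE -scalerAr -texpD addNr.
  by rewrite scalerA mulVf // scale1r.
move=> w; have [w' w'N w'E] := W_mul_closed oneN (lsub_valP w).
suff -> : w = w' by [].
by apply: val_inj; rewrite w'E mulr1.
Qed.

End WIrreducible.

(** * The layers of a lowest weight module *)

From mathcomp Require Import all_fingroup.

Lemma lincomb_loop_br (k : fieldType) (V : lmodType k) (g : loop_sl2 k -> V)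
    (x y : loop_sl2 k) :
  lincomb g (lie_br x y)
    = lincomb (fun z => g (z, x.2 + y.2)) (sl2_br k x.1 y.1).
Proof.
rewrite /lie_br /= /loop_br /loop_tensor.
rewrite [X in lincomb g X]/lincomb linear_sum; apply: eq_bigr => z _.
by rewrite linearZ /= lincombU scale1r.
Qed.

Section LoopRelations.
Variables (k : fieldType) (V : grmod (loop_sl2 k)).
Local Notation ee j := (gm_act V (sl2_e, j)).
Local Notation ff j := (gm_act V (sl2_f, j)).
Local Notation hh j := (gm_act V (sl2_h, j)).

Lemma loop_actE (x y : loop_sl2 k) v :
  gm_act V x (gm_act V y v) = gm_act V y (gm_act V x v)
    + lincomb (fun z => gm_act V (z, x.2 + y.2) v) (sl2_br k x.1 y.1).
Proof.
have := gm_act_br x y v; move/eqP; rewrite subr_eq => /eqP ->.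
by rewrite addrC lincomb_loop_br.
Qed.

Lemma ff_comm i j v : ff i (ff j v) = ff j (ff i v).
Proof. by rewrite loop_actE /= linear0 addr0. Qed.

Lemma hh_ff i j v : hh i (ff j v) = ff j (hh i v) - 2%:R *: ff (i + j) v.
Proof. by rewrite loop_actE /= linearN linearZ /= lincombU scale1r. Qed.

Lemma ee_ff i j v : ee i (ff j v) = ff j (ee i v) + hh (i + j) v.
Proof. by rewrite loop_actE /= lincombU scale1r. Qed.

End LoopRelations.

Lemma natr_inj (k : fieldType) m n : [pchar k] =i pred0 ->
  m%:R = n%:R :> k -> m = n.
Proof.
move=> k0; wlog le : m n / (m <= n)%N => [wl|] E.
  by case: (leqP m n) => [|/ltnW] le; [exact: wl | symmetry; apply: wl].
apply/eqP; rewrite eqn_leq le /= -subn_eq0 -((pcharf0P _).1 k0).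
by rewrite natrB // E subrr.
Qed.

(** * Words in the f(j), and the action of H on them *)

Section LowestWords.
Variables (k : fieldType) (V : grmod (loop_sl2 k)) (u0 : V).
Local Notation ee j := (gm_act V (sl2_e, j)).
Local Notation ff j := (gm_act V (sl2_f, j)).
Local Notation hh j := (gm_act V (sl2_h, j)).
Hypothesis ee_u0 : forall j, ee j u0 = 0.
Hypothesis hh_u0 : forall j, hh j u0 = 0.
Hypothesis V_ind : forall S : V -> Prop, S 0 ->
  (forall c u v, S u -> S v -> S (c *: u + v)) ->
  (forall x v, S v -> S (gm_act V x v)) -> S u0 -> forall v, S v.

Definition fword (s : seq int) : V := foldr (fun j v => ff j v) u0 s.

Lemma fword_perm s t : perm_eq s t -> fword s = fword t.
Proof.
have fword_cons j r u : fword (r ++ j :: u) = ff j (fword (r ++ u)).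
  by elim: r => //= i r ->; exact: ff_comm.
have fword_catCA r s' t' : fword (r ++ s' ++ t') = fword (s' ++ r ++ t').
  by elim: r => //= j r IH; rewrite (fword_cons j s') IH.
by move=> st; apply: (catCA_perm_ind (P := fun u => fword s = fword u)) st _ => //
  r1 r2 r3 ->.
Qed.

Lemma hh0_fword s : hh 0 (fword s) = - (2 * size s)%:R *: fword s.
Proof.
elim: s => [|j s IH] /=; first by rewrite hh_u0 muln0 oppr0 scale0r.
rewrite hh_ff IH add0r linearZ /= -scalerBl; congr (_ *: _).
by rewrite mulnS natrD -opprD addrC.
Qed.

Definition fspan (P : pred nat) : V -> Prop :=
  in_span (fun v => exists2 s, P (size s) & v = fword s).

Lemma ff_fspan (P Q : pred nat) j v :
  (forall r, P r -> Q r.+1) -> fspan P v -> fspan Q (ff j v).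
Proof.
move=> PQ; apply: in_span_lin => _ [s Ps ->]; apply: in_span_gen.
by exists (j :: s) => //=; apply: PQ.
Qed.

Lemma hh_fword i s : fspan predT (hh i (fword s)).
Proof.
elim: s => [|j s IH] /=; first by rewrite hh_u0; exact: in_span0.
rewrite hh_ff; apply: in_span_add; first exact: ff_fspan IH.
rewrite -scaleNr; apply: in_span_scale; apply: in_span_gen.
by exists (i + j :: s).
Qed.

Lemma ee_fword i s : fspan predT (ee i (fword s)).
Proof.
elim: s => [|j s IH] /=; first by rewrite ee_u0; exact: in_span0.
by rewrite ee_ff; apply: in_span_add; [exact: ff_fspan IH | exact: hh_fword].
Qed.

(** The span of the words is stable: moving h(i) or e(i) to the right through a word only produces
    words, until it reaches [u0] and kills it. *)
Lemma V_fspan v : fspan predT v.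
Proof.
elim/V_ind: v => [|c u v uS vS|[x j] v|]; first exact: in_span0.
- by apply: in_span_add => //; exact: in_span_scale.
- apply: in_span_lin => _ [s _ ->].
  case: x; [exact: ee_fword| |exact: hh_fword].
  by apply: in_span_gen; exists (j :: s).
- by apply: in_span_gen; exists [::].
Qed.

Hypothesis k0 : [pchar k] =i pred0.

(* A product of operators [hh 0 - r] with all r <> -2n sends every f-word of
   length <> n to 0 and acts on the -2n eigenspace by a non-zero scalar. *)
Definition kill (rs : seq k) (v : V) : V :=
  foldr (fun r w => hh 0 w - r *: w) v rs.

Lemma kill_linear rs : linear (kill rs).
Proof.
elim: rs => [//|r rs IH] c u v /=; rewrite IH linearP /=.
by rewrite scalerBr scalerDr opprD addrACA !scalerA [r * c]mulrC.
Qed.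

Lemma kill_eigen rs c v : hh 0 v = c *: v ->
  kill rs v = (\prod_(r <- rs) (c - r)) *: v.
Proof.
move=> vc; elim: rs => [|r rs IH]; first by rewrite big_nil scale1r.
rewrite big_cons /= IH linearZ /= vc !scalerA -scalerBl; congr (_ *: _).
by rewrite mulrBl [_ * c]mulrC.
Qed.

(** Let [w] collect the words of length n in [v]. A product of operators [hh 0 - r] with r <> -2n
    kills [v - w], but it acts on this vector of weight -2n by a non-zero scalar, so [v = w]. *)
Lemma weight_fspan n v : hh 0 v = - (2 * n)%:R *: v -> fspan (pred1 n) v.
Proof.
set c := - _ => vc.
have [w [wn wc [rs rsc rs0]]] : exists w, [/\ fspan (pred1 n) w, hh 0 w = c *: w &
    exists2 rs, c \notin rs & kill rs (v - w) = 0].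
  elim: (V_fspan v) => [|a _ u [s _ ->] _ [w [wn wc [rs rsc rs0]]]].
    exists 0; split; rewrite ?linear0 ?scaler0 //; first exact: in_span0.
    by exists [::]; rewrite //= addr0.
  have hs := hh0_fword s; have [sn|sn] := eqVneq (size s) n.
    exists (a *: fword s + w); split.
    - by apply: in_spanD => //; exists s; rewrite // sn /=.
    - by rewrite linearP wc /= hs sn scalerDr !scalerA [a * _]mulrC.
    - by exists rs => //; rewrite opprD addrACA subrr add0r.
  exists w; split=> //; exists (- (2 * size s)%:R :: rs).
    rewrite in_cons negb_or rsc andbT eqr_opp.
    (* In characteristic zero, words of different lengths have different weights. *)
    apply: contra_neqN sn => /eqP /(natr_inj k0)/eqP.
    by rewrite eqn_mul2l /= => /eqP.
  rewrite /= -addrA.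
  rewrite kill_linear rs0 addr0 (kill_eigen _ hs) scalerA linearZ /= hs.
  by rewrite !scalerA -scalerBl mulrC subrr scale0r.
suff -> : v = w by [].
apply/eqP; rewrite -subr_eq0; move: rs0; rewrite (@kill_eigen rs c).
  move/eqP; rewrite scaler_eq0 => /orP[|//]; rewrite prodf_seq_eq0.
  case/hasP => r rrs /= /eqP/subr0_eq cr.
  by rewrite cr rrs in rsc.
by rewrite linearB wc vc scalerBr.
Qed.

Variable n : nat.
Implicit Types (chi eta : 'I_n -> int) (s : 'S_n).

Definition lowest_layer : grmod (cartan k) :=
  grsub (weight_submod (res_cartan V) (- (2 * n)%:R)).
Local Notation Ln := lowest_layer.

Definition fchi chi : V := fword [seq chi i | i <- enum 'I_n].

Lemma fchi_weight chi :
  fchi chi \in weight_submod (res_cartan V) (- (2 * n)%:R).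
Proof. by apply/eqP; rewrite [LHS]hh0_fword size_map size_enum_ord. Qed.

Definition lword chi : Ln := LSub (fchi_weight chi).

Lemma eq_lword chi eta : chi =1 eta -> lword chi = lword eta.
Proof. by move=> /funext ->. Qed.

Lemma lword_perm chi s : lword (chi \o s) = lword chi.
Proof.
apply: val_inj; apply: fword_perm; rewrite (map_comp chi s); apply: perm_map.
apply: uniq_perm => [||i]; rewrite ?enum_uniq //.
  by rewrite map_inj_uniq ?enum_uniq //; exact: perm_inj.
rewrite mem_enum; apply/mapP; exists ((s^-1)%g i); rewrite ?mem_enum //.
by rewrite permKV.
Qed.

Definition shift chi i (j : int) : 'I_n -> int :=
  fun a => chi a + (if a == i then j else 0).

(** h(j) acts as a derivation, replacing each f(i) in turn by -2 f(i + j). The indices in [r] being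
    distinct, [shift] alters a single letter. *)
Lemma hh_map (r : seq 'I_n) chi j : uniq r -> hh j (fword (map chi r)) =
  - 2%:R *: \sum_(i <- r) fword (map (shift chi i j) r).
Proof.
elim: r => [|a r IH] /=; first by rewrite hh_u0 big_nil scaler0.
case/andP=> ar ur; rewrite hh_ff IH // linearZ linear_sum /= big_cons.
have shr i : i \in r -> ff (shift chi i j a) (fword (map (shift chi i j) r))
    = ff (chi a) (fword (map (shift chi i j) r)).
  by move=> ir; rewrite /shift; case: eqP ir ar => [->->//|]; rewrite addr0.
rewrite [in RHS](eq_big_seq _ shr) scalerDr [LHS]addrC; congr (_ + _).
rewrite -scaleNr; congr (_ *: _).
have -> : shift chi a j a = j + chi a by rewrite /shift eqxx addrC.
congr (ff _ (fword _)).
by apply/eq_in_map => i ir; rewrite /shift; case: eqP ir ar => [->->//|];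
  rewrite addr0.
Qed.

Lemma act_lword j chi :
  gm_act Ln j (lword chi) = - 2%:R *: \sum_i lword (shift chi i j).
Proof.
apply: val_inj; rewrite linearZ linear_sum /= [LHS]hh_map ?enum_uniq //.
by rewrite big_enum.
Qed.

Lemma lword_span v : in_span (fun w => exists chi, w = lword chi) v.
Proof.
have [x xv xs] : exists2 x : Ln, lsub_val x = lsub_val v &
    in_span (fun w => exists chi, w = lword chi) x.
  have /weight_fspan : hh 0 (lsub_val v) = - (2 * n)%:R *: lsub_val v.
    exact/eqP/(lsub_valP v).
  elim=> [|c _ w [t /eqP tn ->] _ [x xw xs]].
    by exists 0 => //; exact: in_span0.
  have [chi chiE] : exists chi, fchi chi = fword t.
    (* The default 0 is never read, as [t] has length n. *)
    exists (fun i => nth 0 t i); congr fword.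
    rewrite (map_comp (nth 0 t) val) val_enum_ord.
    by rewrite map_nth_iota0 ?tn // -tn take_size.
  exists (c *: lword chi + x); first by rewrite -chiE -xw.
  by apply: in_spanD => //; exists chi.
by rewrite -(val_inj xv).
Qed.

(* Families [X chi] that some polynomial in the h(j) produces from [lword chi],
   uniformly in [chi]. *)
Definition realizable (X : ('I_n -> int) -> Ln) : Prop :=
  exists2 T, hop T & forall chi, T (lword chi) = X chi.

Lemma real_lin c X Y : realizable X -> realizable Y ->
  realizable (fun chi => c *: X chi + Y chi).
Proof.
move=> [T hT TX] [S hS SY]; exists (fun v => c *: T v + S v);
  first exact: hop_lin.
by move=> chi; rewrite TX SY.
Qed.

Lemma real0 : realizable (fun=> 0).
Proof.
exists (fun v => (-1) *: id v + id v); first by apply: hop_lin; exact: hop_id.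
by move=> chi; rewrite scaleN1r addNr.
Qed.

Lemma real_sum (I : Type) (r : seq I) (P : pred I) X :
  (forall i, P i -> realizable (X i)) ->
  realizable (fun chi => \sum_(i <- r | P i) X i chi).
Proof.
move=> XP; elim: r => [|i r IH].
  by have [T hT TX] := real0; exists T => // chi; rewrite big_nil TX.
have [Pi|Pi] := boolP (P i); last first.
  by have [T hT TX] := IH; exists T => // chi; rewrite big_cons (negbTE Pi) TX.
have [T hT TX] := real_lin 1 (XP i Pi) IH.
by exists T => // chi; rewrite big_cons Pi TX scale1r.
Qed.

(** The class of t^chi times the symmetrization of t^eta over all of S_n, so that each term of m_eta
    is counted as often as the stabilizer of eta has elements. *)
Definition lsym eta chi : Ln :=
  \sum_(s : 'S_n) lword (fun i => chi i + eta (s i)).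

Lemma lsym_perm eta chi s : lsym (eta \o s) chi = lsym eta chi.
Proof.
rewrite /lsym [RHS](reindex_inj (@mulIg _ s)); apply: eq_bigr => t _.
by apply: eq_lword => i; rewrite /= permM.
Qed.

(* The analogue of p_j m_eta = sum_i m_(eta + j e_i) for the power sum p_j and
   the monomial symmetric functions m_eta. *)
Lemma act_lsym j eta chi :
  gm_act Ln j (lsym eta chi) = - 2%:R *: \sum_i lsym (shift eta i j) chi.
Proof.
rewrite /lsym linear_sum exchange_big scaler_sumr; apply: eq_bigr => s _ /=.
rewrite act_lword (reindex_inj (@perm_inj _ (s^-1)%g)); congr (_ *: _).
apply: eq_bigr => i _; apply: eq_lword => a; rewrite /shift addrA.
by congr (_ + _); rewrite -(inj_eq (@perm_inj _ s)) permKV.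
Qed.

Lemma real_act j X :
  realizable X -> realizable (fun chi => gm_act Ln j (X chi)).
Proof.
move=> [T hT TX]; exists (fun v => gm_act Ln j (T v)); first exact: hop_act.
by move=> chi; rewrite TX.
Qed.

Lemma eq_real X Y : X =1 Y -> realizable X -> realizable Y.
Proof. by move=> /funext ->. Qed.

(** This is the generation of symmetric functions by power sums, by induction on the number of
    non-zero entries of [eta]. Replace one non-zero entry [eta i0] by 0 and apply h([eta i0]): a
    shift at a zero entry gives back [eta] up to a transposition, while a shift at a non-zero entry
    leaves fewer non-zero entries than [eta] has. *)
Lemma lsym_realizable eta : realizable (lsym eta).
Proof.
move: {2}(#|_|) (leqnn #|[set i | eta i != 0]|) => r.
elim: r eta => [|r IH] eta leta.
  (* For eta = 0 the operator is n! times the identity, written as (n! - 1) id + id to fit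
     [hop_lin]. *)
  exists (fun v => (#|{: 'S_n}|%:R - 1) *: id v + id v).
    by apply: hop_lin; exact: hop_id.
  move=> chi; rewrite scalerBl scale1r subrK /lsym scaler_nat -sumr_const.
  apply: eq_bigr => s _; apply: eq_lword => i.
  move: leta; rewrite leqn0 cards_eq0 => /eqP/setP/(_ (s i)); rewrite !inE.
  by move/negbFE/eqP => ->; rewrite addr0.
have [/eqP|] := boolP ([set i | eta i != 0] == set0).
  by move=> eta0; apply: IH; rewrite eta0 cards0.
case/set0Pn => i0; rewrite inE => eta0.
pose eta' i := if i == i0 then 0 else eta i.
have leta' : (#|[set i | eta' i != 0]| <= r)%N.
  rewrite -ltnS; apply: leq_trans leta; apply: proper_card; apply/properP.
  split; last by exists i0; rewrite !inE /eta' ?eqxx.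
  by apply/subsetP => i; rewrite !inE /eta'; case: ifP; rewrite ?eqxx.
have shiftN i : eta' i != 0 -> realizable (lsym (shift eta' i (eta i0))).
  move=> e'i; apply: IH; apply: leq_trans leta'; apply: subset_leq_card.
  apply/subsetP => a; rewrite !inE; apply: contra_neq => e'a.
  by rewrite /shift; case: eqP => [ai|];
    [rewrite -ai e'a eqxx in e'i | rewrite e'a addr0].
have shift0 i chi : eta' i == 0 -> lsym (shift eta' i (eta i0)) chi = lsym eta chi.
  move=> /eqP e'i; rewrite -(lsym_perm eta chi (tperm i0 i)); congr lsym.
  apply/funext => a; rewrite /shift /= ;
    case: tpermP => [->|->|/eqP ai0 /eqP ai].
  - move: e'i; rewrite /eta' eqxx eq_sym add0r;
    case: (eqVneq i i0) => [->//|_ ->] //.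
  - by rewrite eqxx e'i add0r.
  - by rewrite (negbTE ai) /eta' (negbTE ai0) addr0.
pose c := #|[pred i | eta' i == 0]|.
have c0 : c%:R != 0 :> k.
  rewrite ((pcharf0P _).1 k0) -lt0n; apply/card_gt0P; exists i0.
  by rewrite inE /eta' eqxx.
have two0 : - 2%:R != 0 :> k by rewrite oppr_eq0 ((pcharf0P _).1 k0).
have R1 := real_act (eta i0) (IH eta' leta').
have R2 : realizable (fun chi => \sum_(i | eta' i != 0) lsym (shift eta' i (eta i0)) chi).
  exact: real_sum.
(* Solve [act_lsym] for [lsym eta], which occurs [c] times with the factor -2. *)
apply: eq_real (real_lin (- c%:R^-1) R2 (real_lin (c%:R^-1 * (- 2%:R)^-1) R1 real0)).
move=> chi; rewrite addr0 act_lsym scalerA -mulrA mulVf // mulr1 scaleNr.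
rewrite addrC -scalerBr.
apply: (scalerI c0); rewrite scalerA divff // scale1r.
rewrite (bigID (fun i => eta' i != 0)) /= addrAC subrr add0r.
under eq_bigl => i do rewrite negbK.
by rewrite (eq_bigr _ (fun i => @shift0 i chi)) sumr_const scaler_nat.
Qed.

End LowestWords.

(** * The Nullstellensatz *)

From mathcomp Require Import ring bigenough.
From mathcomp.multinomials Require Import ssrcomplements mpoly.
Import BigEnough.

(* The library [monalg] has another [{mpoly _[_]}]. *)
Local Notation "{ 'mpoly' R [ n ] }" := (mpoly n R) : type_scope.

(** * Extending a point along an integral extension *)

Section LyingOver.
Variables (S R : comNzRingType) (k : fieldType).
Variables (s : {rmorphism S -> R}) (c : {rmorphism S -> k}).
Hypothesis ker_sc : forall z, s z = 0 -> c z = 0.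
Variables (x : R) (G : {poly S}).
Hypotheses (Gmonic : G \is monic) (Gx : (map_poly s G).[x] = 0).

(* Multiplication by [p] on S[T]/(G) has a matrix M over S; the vector of powers
   of [x] is killed by the image of M in R, hence so is det M, while over k the
   matrix M becomes the scalar [c0]. *)
Lemma integral_const_eq0 (p : {poly S}) (c0 : k) :
  (map_poly s p).[x] = 0 -> map_poly c p = c0%:P -> c0 = 0.
Proof.
move=> px pc; pose d := (size G).-1.
have sG : size G = d.+1.
  by rewrite prednK // lt0n size_poly_eq0 monic_neq0.
(* A monic polynomial of degree 0 is 1, which has no root in the non-zero ring [R]. *)
have d_gt0 : (0 < d)%N.
  rewrite lt0n; apply/eqP => d0; move: Gx.
  have /eqP : size G == 1 by rewrite sG d0.
  move=> /eqP/size_poly1P [a a0 Ga]; move: Gmonic.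
  rewrite Ga monicE lead_coefC => /eqP -> /eqP.
  by rewrite rmorph1 hornerC oner_eq0.
pose r i := Pdiv.Ring.rmodp ('X^i * p) G.
pose q i := Pdiv.Ring.rdivp ('X^i * p) G.
have rE i : 'X^i * p = q i * G + r i by exact: (Pdiv.RingMonic.rdivp_eq Gmonic).
have sr i : (size (r i) <= d)%N.
  by rewrite -ltnS -sG Pdiv.Ring.ltn_rmodp monic_neq0.
pose M : 'M[S]_d := \matrix_(i, j) (r i)`_j.
pose v : 'cV[R]_d := \col_j x ^+ j.
have Mv : map_mx s M *m v = 0.
  apply/colP => i; rewrite !mxE.
  have : (map_poly s (r i)).[x] = 0.
    have := congr1 (fun t => (map_poly s t).[x]) (rE i).
    rewrite !rmorphM rmorphD !rmorphM /= hornerM px mulr0.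
    by rewrite hornerD hornerM Gx mulr0 add0r.
  have srs : (size (map_poly s (r i)) <= d)%N.
    by apply: leq_trans (size_poly _ _) (sr i).
  rewrite (horner_coef_wide _ srs); apply: etrans; apply: eq_bigr => j _.
  by rewrite !mxE coef_map.
have detM : s (\det M) = 0.
  have : (\det (map_mx s M)) *: v = 0.
    by rewrite -mul_scalar_mx -mul_adj_mx -mulmxA Mv mulmx0.
  (* The first entry of [v] is x^0 = 1. *)
  move/colP => /(_ (Ordinal d_gt0)); rewrite !mxE expr0 mulr1 => <-.
  by rewrite det_map_mx.
have Mc : map_mx c M = c0%:M.
  apply/matrixP => i j; rewrite !mxE.
  have Gc : size (map_poly c G) = d.+1 by rewrite size_map_poly_id0 ?sG //
    (eqP Gmonic) rmorph1 oner_neq0.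
  have e1 : map_poly c (r i) = 'X^i * c0%:P %% map_poly c G.
    apply: (@modpP _ _ (map_poly c (q i))); last first.
      by rewrite Gc ltnS; apply: leq_trans (size_poly _ _) (sr i).
    by rewrite -pc -rmorphM -rmorphD -rE rmorphM /= map_polyXn.
  have e2 : 'X^i * c0%:P = 'X^i * c0%:P %% map_poly c G.
    apply: (@modpP _ _ 0); first by rewrite mul0r add0r.
    rewrite Gc ltnS mulrC mul_polyC.
    by apply: leq_trans (size_scale_leq _ _) _; rewrite size_polyXn.
  rewrite -coef_map e1 -e2 mulrC coefCM coefXn eq_sym -val_eqE /=.
  by case: eqP => _; rewrite ?mulr1 ?mulr0 // ?mulr1n ?mulr0n.
move: (ker_sc detM); rewrite -det_map_mx Mc det_scalar => /eqP.
by rewrite expf_eq0 => /andP[_ /eqP].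
Qed.

Hypothesis k_closed : GRing.closed_field_axiom k.
Hypothesis c_surj : forall z, exists u, c u = z.

Lemma closed_field_root (q : {poly k}) : (1 < size q)%N -> exists z, root q z.
Proof.
move=> sq; pose n := (size q).-1.
have qn : size q = n.+1 by rewrite prednK // (leq_trans _ sq).
have l0 : lead_coef q != 0 by rewrite lead_coef_eq0 -size_poly_gt0 qn.
have n0 : (0 < n)%N by rewrite -ltnS -qn.
have [z zP] := k_closed (fun i => - (q`_i / lead_coef q)) n0; exists z.
rewrite rootE horner_coef qn big_ord_recr /= zP mulr_sumr -big_split /=.
apply/eqP/big1 => i _; rewrite /lead_coef -/n mulNr mulrN mulrA.
by rewrite [q`_n * _]mulrC divfK ?subrr // -/(lead_coef q).
Qed.

Lemma map_poly_surj (q : {poly k}) : exists u : {poly S}, map_poly c u = q.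
Proof.
elim/poly_ind: q => [|q a [u <-]]; first by exists 0; rewrite rmorph0.
have [b <-] := c_surj a; exists (u * 'X + b%:P).
by rewrite rmorphD rmorphM /= map_polyX map_polyC.
Qed.

(** The images under [c] of the polynomials vanishing at [x] form an ideal [J] of k[T]. It is
    non-zero because of [G], and proper by [integral_const_eq0]; a root of its element of least
    degree is a common zero. *)
Lemma integral_extend_point : exists b : k,
  forall p : {poly S}, (map_poly s p).[x] = 0 -> (map_poly c p).[b] = 0.
Proof.
pose J (q : {poly k}) := exists2 p, (map_poly s p).[x] = 0 & map_poly c p = q.
have JM u q : J q -> J (u * q).
  move=> [p px <-]; have [v <-] := map_poly_surj u.
  by exists (v * p); rewrite ?rmorphM // hornerM px mulr0.
have JB q q' : J q -> J q' -> J (q - q').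
  move=> [p px <-] [p' px' <-].
  by exists (p - p'); rewrite ?rmorphB // hornerD hornerN px px' subr0.
have exn : exists n, `[< exists q, [/\ J q, q != 0 & size q = n] >].
  exists (size (map_poly c G)); apply/asboolP; exists (map_poly c G).
  split=> //; first by exists G.
  by rewrite monic_neq0 // monic_map.
case: (ex_minnP exn) => n /asboolP[q [Jq q0 sq]] nmin.
have s1 : (1 < size q)%N.
  case: Jq => p px pq; rewrite ltnNge; apply/negP => /size1_polyC qc.
  by move/eqP: q0; apply; rewrite qc (integral_const_eq0 px (etrans pq qc)).
have [b /rootP qb] := closed_field_root s1; exists b => p px.
have Jp : J (map_poly c p) by exists p.
have Jr : J (map_poly c p %% q).
  by rewrite -[_ %% q](addKr (map_poly c p %/ q * q)) -divp_eq addrC;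
    apply: JB => //; exact: JM.
have r0 : map_poly c p %% q = 0.
  apply/eqP/negPn/negP => r0; have := ltn_modp (map_poly c p) q.
  rewrite q0 ltnNge sq => /negP; apply; apply: nmin; apply/asboolP.
  by exists (map_poly c p %% q).
by rewrite (divp_eq (map_poly c p) q) r0 addr0 hornerM qb mulr0.
Qed.

End LyingOver.

Lemma mpoly_rmorph_ext (k : nzRingType) (m : nat) (S : nzRingType)
    (F1 F2 : {rmorphism {mpoly k[m]} -> S}) :
  (forall c, F1 c%:MP = F2 c%:MP) -> (forall i, F1 'X_i = F2 'X_i) ->
  F1 =1 F2.
Proof.
move=> FC FX p; rewrite (mpolyE p) !rmorph_sum; apply: eq_bigr => mu _.
rewrite -mul_mpolyC !rmorphM /= FC; congr (_ * _).
rewrite mpolyXE_id !rmorph_prod; apply: eq_bigr => i _.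
by rewrite !rmorphXn /= FX.
Qed.

Lemma digits_inj (N m : nat) (u v : 'I_m -> nat) :
  (forall i, u i < N)%N -> (forall i, v i < N)%N ->
  (\sum_i u i * N ^ i = \sum_i v i * N ^ i)%N -> u =1 v.
Proof.
elim: m u v => [|m IH] u v uN vN; first by move=> _ [].
have shift (w : 'I_m.+1 -> nat) :
    (\sum_i w i * N ^ i = \sum_(i < m) w (lift ord0 i) * N ^ i * N + w ord0)%N.
  rewrite big_ord_recl expn0 muln1 addnC; congr addn; apply: eq_bigr => i _.
  by rewrite lift0 expnSr mulnA.
rewrite !shift -!big_distrl /= => E.
have E0 : u ord0 = v ord0.
  by have := congr1 (modn^~ N) E; rewrite !modnMDl !modn_small.
have N0 : (0 < N)%N by apply: leq_ltn_trans (uN ord0).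
have E1 := IH (fun i => u (lift ord0 i)) (fun i => v (lift ord0 i)).
move: E; rewrite E0 => /addIn/eqP; rewrite eqn_pmul2r // => /eqP/E1 {}E1 i.
by case: (unliftP ord0 i) => [j ->|->] //; apply: E1.
Qed.

(** * Nagata's change of variables *)

Section Nagata.
Variables (k : fieldType) (m N : nat).
Local Notation Y := {mpoly k[m]}.

(** X_0 becomes the main variable T and X_(j+1) becomes X_j + T^(N^(j+1)), so that a monomial mu
    becomes monic in T of degree sum_i mu_i N^i. *)
Definition nagata_var (i : 'I_m.+1) : {poly Y} :=
  if unlift ord0 i is Some j then ('X_j)%:P + 'X^(N ^ j.+1) else 'X.

Definition nagata : {mpoly k[m.+1]} -> {poly Y} :=
  mmap (polyC \o (@mpolyC m k)) nagata_var.

HB.instance Definition _ :=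
  GRing.RMorphism.copy nagata (mmap (polyC \o @mpolyC m k) nagata_var).

Lemma nagataC c : nagata c%:MP = (c%:MP)%:P.
Proof. exact: mmapC. Qed.

Lemma nagataX i : nagata 'X_i = nagata_var i.
Proof. by rewrite /nagata mmapX mmap1U. Qed.

Lemma monic_sizeM (p q : {poly Y}) (d e : nat) :
  p \is monic /\ size p = d.+1 -> q \is monic /\ size q = e.+1 ->
  p * q \is monic /\ size (p * q) = (d + e).+1.
Proof.
move=> [mp sp] [mq sq]; split; first by rewrite monicMr.
by rewrite size_Mmonic ?monic_neq0 // sp sq addnS.
Qed.

Lemma monic_sizeX (p : {poly Y}) (d e : nat) :
  p \is monic /\ size p = d.+1 ->
  p ^+ e \is monic /\ size (p ^+ e) = (e * d).+1.
Proof.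
move=> P; elim: e => [|e IH]; first by rewrite expr0 monic1 size_poly1.
by rewrite exprS mulSn; apply: monic_sizeM.
Qed.

Lemma nagata_var_monic (i : 'I_m.+1) : (0 < N)%N ->
  nagata_var i \is monic /\ size (nagata_var i) = (N ^ i).+1.
Proof.
move=> N0; rewrite /nagata_var; case: unliftP => [j ->|->]; last first.
  by rewrite monicX size_polyX expn0.
have sl : (size (('X_j)%:P : {poly Y}) < size ('X^(N ^ j.+1) : {poly Y}))%N.
  by rewrite size_polyXn ltnS (leq_trans (size_polyC_leq1 _)) // expn_gt0 N0.
rewrite lift0 addrC; split; last by rewrite size_polyDl // size_polyXn.
by rewrite monicE lead_coefDl // lead_coefXn.
Qed.

Definition nagata_weight (mu : 'X_{1..m.+1}) : nat := \sum_i mu i * N ^ i.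

Lemma nagata_mon_monic mu : (0 < N)%N ->
  mmap1 nagata_var mu \is monic /\
  size (mmap1 nagata_var mu) = (nagata_weight mu).+1.
Proof.
move=> N0; rewrite /mmap1 /nagata_weight.
elim/big_rec2: _ => [|i d p _ IH]; first by rewrite monic1 size_poly1.
apply: monic_sizeM IH.
exact: monic_sizeX (nagata_var_monic i N0).
Qed.

End Nagata.

(** For large N, the exponents of a monomial are the base N digits of its degree in T. Distinct
    monomials then have distinct degrees, and the highest one alone determines the leading
    coefficient, a non-zero constant. *)
Lemma nagata_monic (k : fieldType) (m : nat) (g : {mpoly k[m.+1]}) : g != 0 ->
  exists N a, a *: nagata N g \is monic.
Proof.
(* [msize g] is the total degree plus one, so it exceeds every exponent. *)
move=> g0; pose N := msize g; exists N.
have muN mu i : mu \in msupp g -> (mu i < N)%N.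
  move=> /msize_mdeg_lt; apply: leq_ltn_trans.
  by rewrite mdegE (bigD1 i) //= leq_addr.
have [mu0 mu0g] : exists mu0, mu0 \in msupp g.
  by move: g0; rewrite -msupp_eq0; case: (msupp g) => // mu ? _; exists mu;
    rewrite inE eqxx.
have N0 : (0 < N)%N by apply: leq_ltn_trans (muN _ ord0 mu0g).
pose w := @nagata_weight m N.
pose Q d := has (fun mu => w mu == d) (msupp g).
have exQ : exists d, Q d by exists (w mu0); apply/hasP; exists mu0.
have Qle d : Q d -> (d <= \sum_(mu <- msupp g) w mu)%N.
  move=> /hasP[mu mug /eqP <-].
  by rewrite (big_rem mu) //= leq_addr.
case: (ex_maxnP exQ Qle) => d /hasP[mu mug /eqP wmu] dmax.
exists (g@_mu)^-1%:MP.
have coefd nu : nu \in msupp g ->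
    (mmap1 (nagata_var k N) nu)`_d = (nu == mu)%:R :> {mpoly k[m]}.
  move=> nug; have [nm ns] := nagata_mon_monic k nu N0.
  have [->|ne] := eqVneq nu mu.
    have [mm ms] := nagata_mon_monic k mu N0.
    by move: mm; rewrite monicE /lead_coef ms /= -/(w mu) wmu => /eqP.
  apply: nth_default; rewrite ns -/(w nu) ltn_neqAle dmax; last first.
    by apply/hasP; exists nu.
  rewrite andbT; apply: contraNneq ne => /esym wd; apply/eqP/mnmP => i.
  apply/esym; apply: (@digits_inj N _ (fun i => mu i) (fun i => nu i)) => //.
  - by move=> j; exact: muN.
  - by move=> j; exact: muN.
  - by rewrite -[LHS]/(w mu) -[RHS]/(w nu) wmu.
have cd : ((g@_mu)^-1%:MP *: nagata N g)`_d = 1.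
  rewrite coefZ /nagata /mmap coef_sum (bigD1_seq mu) //=.
  rewrite coefCM coefd // eqxx mulr1 big1_seq ?addr0; last first.
    by move=> nu /andP[ne nug]; rewrite coefCM coefd // (negbTE ne) mulr0.
  by rewrite -mpolyCM mulVf ?mpolyC1 // mcoeff_eq0 negbK.
have sd : (size ((g@_mu)^-1%:MP *: nagata N g) <= d.+1)%N.
  apply: leq_trans (size_scale_leq _ _) _.
  rewrite /nagata /mmap big_seq; apply: (leq_trans (size_sum _ _ _)).
  apply/bigmax_leqP_seq => nu _ nug; rewrite mul_polyC.
  apply: leq_trans (size_scale_leq _ _) _.
  rewrite (nagata_mon_monic k nu N0).2 ltnS; apply: dmax.
  by apply/hasP; exists nu.
have se : size ((g@_mu)^-1%:MP *: nagata N g) = d.+1.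
  apply/eqP; rewrite eqn_leq sd ltnNge;
    apply/negP => /leq_sizeP/(_ d (leqnn _)).
  by rewrite cd => /eqP; rewrite oner_eq0.
by rewrite monicE /lead_coef se cd.
Qed.

(** Induction on the number of variables. If the x_i satisfy no non-trivial relation, any point will
    do. Otherwise Nagata's substitution makes x_0 integral over the elements [y]; the point found
    for [y] extends to x_0, and undoing the substitution gives [a']. *)
Theorem nullstellensatz (k : fieldType) (R : comNzRingType)
    (f : {rmorphism k -> R}) (m : nat) (x : 'I_m -> R) :
  GRing.closed_field_axiom k ->
  exists a : 'I_m -> k, forall p : {mpoly k[m]}, mmap f x p = 0 -> p.@[a] = 0.
Proof.
move=> kcl; elim: m x => [|m IH] x.
  exists (fun=> 0) => p; have -> : p = (p@_0)%:MP.
    apply/mpolyP => mu; rewrite mcoeffC; case: eqP => [->|ne];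
      rewrite ?mulr1 //.
    by case: ne; apply/mnmP => -[].
  by rewrite mmapC mevalC => /eqP; rewrite fmorph_eq0 => /eqP.
have [[g gx g0]|nog] := pselect (exists2 g, mmap f x g = 0 & g != 0);
  last first.
  exists (fun=> 0) => p px; have [->|p0] := eqVneq p 0; first exact: raddf0.
  by case: nog; exists p.
have [N [a Gm]] := nagata_monic g0.
(* Chosen so that X_(j+1) -> y_j + x_0^(N^(j+1)) recovers x_(j+1). *)
pose y (i : 'I_m) := x (lift ord0 i) - x ord0 ^+ (N ^ i.+1).
have evx p : (map_poly (mmap f y) (nagata N p)).[x ord0] = mmap f x p.
  pose F := horner_eval (x ord0) \o map_poly (mmap f y) \o nagata N.
  apply: (@mpoly_rmorph_ext _ _ _ F (mmap f x)) => [c|i] /=.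
    by rewrite nagataC map_polyC /horner_eval hornerC /= !mmapC.
  rewrite nagataX mmapX mmap1U /nagata_var /horner_eval.
  case: unliftP => [j ->|->]; last by rewrite map_polyX hornerX.
  rewrite rmorphD /= map_polyC map_polyXn hornerD hornerC hornerXn.
  by rewrite /= mmapX mmap1U subrK.
have [b bP] := IH y.
have kersc z : mmap f y z = 0 -> meval b z = 0 by exact: bP.
have Gx : (map_poly (mmap f y) (a *: nagata N g)).[x ord0] = 0.
  by rewrite map_polyZ hornerZ evx gx mulr0.
have csurj z : exists u, meval b u = z by exists z%:MP; rewrite mevalC.
have [c cP] := integral_extend_point kersc Gm Gx kcl csurj.
pose a' i := if unlift ord0 i is Some j then b j + c ^+ (N ^ j.+1) else c.
exists a' => p px; rewrite -{}(cP (nagata N p)) ?evx //.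
pose F := horner_eval c \o map_poly (meval b) \o nagata N.
apply: (@mpoly_rmorph_ext _ _ _ (meval a') F) => [z|i] /=.
  by rewrite nagataC map_polyC /horner_eval hornerC /= !mevalC.
rewrite nagataX mevalXU /a' /nagata_var /horner_eval.
case: unliftP => [j _|_]; last by rewrite map_polyX hornerX.
rewrite rmorphD /= map_polyC map_polyXn hornerD hornerC hornerXn.
by rewrite /= mevalXU.
Qed.

(** The relations among the classes of the variables in the quotient ring, non-zero as I is proper,
    are the elements of I. *)
Corollary ideal_zero (k : fieldType) (m : nat) (I : {pred {mpoly k[m]}}) :
  GRing.closed_field_axiom k -> idealr_closed I ->
  exists a : 'I_m -> k, forall p, p \in I -> p.@[a] = 0.
Proof.
move=> kcl Icl.
pose J : idealr {mpoly k[m]} := HB.pack I (isIdealr.Build _ I Icl).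
pose Q := {ideal_quot J}.
pose f : {rmorphism k -> Q} := \pi_Q \o @mpolyC m k.
have [a aP] := nullstellensatz f (fun i => \pi_Q 'X_i) kcl; exists a => p pI.
apply: aP; have -> : mmap f (fun i => \pi_Q 'X_i) p = \pi_Q p.
  apply: (@mpoly_rmorph_ext _ _ _ (mmap f (fun i => \pi_Q 'X_i)) \pi_Q) => [c|i].
    by rewrite /= mmapC.
  by rewrite /= mmapX mmap1U.
by apply/eqP; rewrite -(rmorph0 \pi_Q) -Quotient.idealrBE subr0.
Qed.

(** * Evaluation at a point of the torus *)

Lemma lincomb_sl2_br (k : fieldType) (V : lmodType k) (g : sl2_basis -> V) x y :
  lincomb g (sl2_br k x y) = sl2_table (g sl2_e) (g sl2_f) (g sl2_h) x y.
Proof.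
have E (f : {linear {malg k[sl2_basis]} -> V}) : f (sl2_br k x y) =
    sl2_table (f << sl2_e >>) (f << sl2_f >>) (f << sl2_h >>) x y.
  by case: x; case: y; rewrite /= ?linear0 ?(linearN f) ?linearZ.
by rewrite (E (lincomb g)) /= !lincombU !scale1r.
Qed.

Section Verma.
Variables (k : fieldType) (n : nat).
Local Notation P := {mpoly k[n]}.

(** The Verma module of weight 0 realized on polynomials in X_i, with X_i^m in the role of f^m
    applied to the generator 1. *)
Definition verma_op (i : 'I_n) (x : sl2_basis) (p : P) : P :=
  match x with
  | sl2_e => - ('X_i * p^`M(i)^`M(i))
  | sl2_f => 'X_i * p
  | sl2_h => - ('X_i * p^`M(i) *+ 2)
  end.

Lemma verma_op_linear i x : linear (verma_op i x).
Proof.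
move=> c p q; case: x => /=;
  rewrite ?mderivD ?mderivZ ?mderivD ?mderivZ mulrDr -scalerAr.
- by rewrite opprD scalerN.
- by [].
- by rewrite mulrnDl opprD scalerN scalerMnr.
Qed.

Canonical verma_op_lin i x : {linear P -> P} := HB.pack (verma_op i x)
  (GRing.isLinear.Build k P P _ (verma_op i x) (verma_op_linear i x)).

Lemma mderivXM i (q : P) : ('X_i * q)^`M(i) = q + 'X_i * q^`M(i).
Proof.
rewrite mderivM mderivX mnm1E eqxx (_ : (_ - _)%MM = 0%MM).
  by rewrite mpolyX0 scale1r mul1r.
by apply/mnmP => l; rewrite mnmBE subnn mnm0E.
Qed.

Lemma mderivXM_neq i j (q : P) : i != j -> ('X_j * q)^`M(i) = 'X_j * q^`M(i).
Proof.
by move=> ij; rewrite mderivM mderivX mnm1E eq_sym (negbTE ij) scale0r mul0r add0r.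
Qed.

Lemma verma_op_br i j x y (p : P) :
  verma_op i x (verma_op j y p) - verma_op j y (verma_op i x p)
    = (i == j)%:R *: lincomb (fun z => verma_op i z p) (sl2_br k x y).
Proof.
have [<-|ij] := eqVneq i j; last first.
  rewrite scale0r; apply/eqP; rewrite subr_eq0; apply/eqP.
  have Di q := mderivXM_neq q ij;
    have Dj (q : P) : ('X_i * q)^`M(j) = 'X_i * q^`M(j).
    by apply: mderivXM_neq; rewrite eq_sym.
  have dd := mderiv_comm i j.
  by case: x; case: y; rewrite /= ?(mderivN, Di, Dj, mderivMn) ?dd ?dd; ring.
rewrite scale1r lincomb_sl2_br.
case: x; case: y; rewrite /= ?(mderivN, mderivXM, mderivMn, mderivD) ?scaler_nat; ring.
Qed.

Variable a : 'I_n -> k.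
Hypothesis a0 : forall i, a i != 0.

(** The tensor product of n Verma modules, x(j) acting on the i-th factor as a_i^j x. *)
Definition verma_act (x : loop_sl2 k) (p : P) : P :=
  \sum_i a i ^ x.2 *: verma_op i x.1 p.

Lemma verma_act_linear x : linear (verma_act x).
Proof.
move=> c p q; rewrite /verma_act scaler_sumr -big_split; apply: eq_bigr => i _.
by rewrite linearP scalerDr !scalerA mulrC.
Qed.

Canonical verma_act_lin x : {linear P -> P} := HB.pack (verma_act x)
  (GRing.isLinear.Build k P P _ (verma_act x) (verma_act_linear x)).

Lemma verma_act_br x y (p : P) :
  verma_act x (verma_act y p) - verma_act y (verma_act x p)
    = lincomb (verma_act^~ p) (lie_br x y).
Proof.
rewrite lincomb_loop_br /verma_act.
have E u v : \sum_i a i ^ u.2 *: verma_op i u.1 (\sum_j a j ^ v.2 *: verma_op j v.1 p)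
    = \sum_i \sum_j (a i ^ u.2 * a j ^ v.2) *: verma_op i u.1 (verma_op j v.1 p).
  apply: eq_bigr => i _; rewrite linear_sum scaler_sumr; apply: eq_bigr => j _.
  by rewrite linearZ scalerA.
rewrite (E x y) (E y x) [X in _ - X]exchange_big -sumrB.
under eq_bigr => i _ do under [X in _ - X]eq_bigr => j _ do rewrite mulrC.
under eq_bigr => i _ do rewrite -sumrB.
under eq_bigr => i _ do under eq_bigr => j _ do rewrite -scalerBr verma_op_br scalerA.
transitivity (\sum_i a i ^ (x.2 + y.2) *:
    lincomb (fun z => verma_op i z p) (sl2_br k x.1 y.1)).
  apply: eq_bigr => i _; rewrite (bigD1 i) //= big1 ?addr0 => [|j ji].
    by rewrite eqxx mulr1 expfzDr.
  by rewrite eq_sym (negbTE ji) mulr0 scale0r.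
rewrite /lincomb; under eq_bigr => i _ do rewrite scaler_sumr.
rewrite exchange_big; apply: eq_bigr => z _; rewrite scaler_sumr.
by apply: eq_bigr => i _; rewrite !scalerA mulrC.
Qed.

Definition mnm_ones : 'X_{1..n} := [multinom 1 | i < n].

Lemma mcoeff_euler i (p : P) m : ('X_i * p^`M(i))@_m = p@_m *+ m i.
Proof.
elim/mpolyind: p => [|c m' p _ _ IH];
  first by rewrite mderiv0 mulr0 !mcoeff0 mul0rn.
rewrite mderivD mderivZ mulrDr !mcoeffD IH mulrnDl; congr (_ + _).
rewrite mderivX -!scalerAr !mcoeffZ -mpolyXD !mcoeffX.
have [mi|mi] := posnP (m' i).
  rewrite mi mul0r mulr0; case: eqP => [<-|_]; first by rewrite mi mulr0n.
  by rewrite mulr0 mul0rn.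
rewrite addmC submK; last first.
  by apply/mnm_lepP => l; rewrite mnm1E; case: eqP => [<-|].
by case: eqP => [->|_]; [rewrite !mulr1 mulr_natr | rewrite !mulr0 mul0rn].
Qed.

(** In the expansion of the product, a choice of one term in each factor yields X_1 ... X_n exactly
    when it is a permutation; the result is the permanent of [c]. *)
Lemma mcoeff_ones_prod (c : 'I_n -> 'I_n -> k) :
  (\prod_i \sum_j c i j *: 'X_j : P)@_mnm_ones = \sum_(s : 'S_n) \prod_i c i (s i).
Proof.
rewrite bigA_distr_bigA /= raddf_sum /=.
have E (g : {ffun 'I_n -> 'I_n}) : (\prod_i (c i (g i) *: 'X_(g i)) : P)@_mnm_ones
    = \prod_i c i (g i) * (injectiveb g)%:R.
  rewrite scaler_prod mcoeffZ mprodXE mcoeffX; congr (_ * _%:R);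
    congr nat_of_bool.
  apply/eqP/injectiveP => [/mnmP E i j gij|gi].
    apply/eqP/negP => /negP ij; have := E (g i); rewrite mnm_sumE mnmE.
    rewrite (bigD1 i) //= (bigD1 j) 1?eq_sym //= !mnm1E -gij !eqxx.
    by [].
  apply/mnmP => l; rewrite mnm_sumE mnmE; have [h hK gK] := injF_bij gi.
  rewrite (bigD1 (h l)) //= mnm1E gK eqxx big1 // => i ne.
  by rewrite mnm1E; case: eqP => // gil; rewrite -gil hK eqxx in ne.
under eq_bigr => g _ do rewrite E.
rewrite (bigID (fun g : {ffun 'I_n -> 'I_n} => injectiveb g)) /= addrC big1 ?add0r.
  rewrite (reindex (fun s : 'S_n => pval s)) /=; last first.
    exists (insubd (1%g : 'S_n)) => [s _|f fi]; first exact: valKd.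
    exact: insubdK.
  apply: eq_big => [s|s si]; first exact: (valP s).
  rewrite si mulr1; apply: eq_bigr => i _; congr (c i _).
  by rewrite pvalE.
by move=> g /negbTE ->; rewrite mulr0.
Qed.

Section Functional.
Variables (V : grmod (loop_sl2 k)) (u0 : V) (Th : {linear V -> P}).
Hypothesis Th_act : forall x v, Th (gm_act V x v) = verma_act x (Th v).
Hypothesis Th_u0 : Th u0 = 1.
Local Notation Ln := (lowest_layer V n).

(** The symmetrized evaluation at [a]: on the word of chi it is the permanent of the a_i^(chi_j), by
    [Th_fword] and [mcoeff_ones_prod]. *)
Definition coef_ones (v : Ln) : k := (Th (lsub_val v))@_mnm_ones.

Lemma coef_ones_is_scalar : scalar coef_ones.
Proof. by move=> c u v; rewrite /coef_ones [Th _]linearP mcoeffD mcoeffZ. Qed.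

Canonical coef_ones_scalar : {scalar Ln} := HB.pack coef_ones
  (GRing.isLinear.Build k Ln k _ coef_ones coef_ones_is_scalar).

(** h(j) is -2 sum_i a_i^j X_i d/dX_i, and each Euler operator X_i d/dX_i fixes the coefficient of
    X_1 ... X_n. *)
Lemma coef_ones_act j v :
  coef_ones (gm_act Ln j v) = (- 2%:R * \sum_i a i ^ j) * coef_ones v.
Proof.
rewrite /coef_ones [Th _]Th_act /verma_act raddf_sum mulr_sumr mulr_suml.
apply: eq_bigr => i _;
  rewrite /= mcoeffZ mcoeffN mcoeffMn mcoeff_euler mnmE mulr1n.
ring.
Qed.

Lemma Th_fword s : Th (fword u0 s) = \prod_(j <- s) \sum_i a i ^ j *: 'X_i.
Proof.
elim: s => [|j s IH]; first by rewrite big_nil.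
rewrite big_cons [Th _]Th_act -/(fword u0 s) IH /verma_act mulr_suml.
by apply: eq_bigr => i _; rewrite /= -scalerAl.
Qed.

End Functional.
End Verma.

(** * Irreducible quotients of the layers *)

Section MpolyLift.
Variables (k : fieldType) (W : lmodType k) (m : nat) (g : 'X_{1..m} -> W).
Implicit Types (b c : {mpoly k[m]}).

Definition mlift b : W := \sum_(mu <- msupp b) b@_mu *: g mu.

Lemma mliftwE d b : (msize b <= d)%N ->
  mlift b = \sum_(mu : 'X_{1..m < d}) b@_mu *: g mu.
Proof.
move=> bd; rewrite /mlift (big_mksub 'X_{1..m < d}) ?msupp_uniq //=; first last.
  by move=> mu /msize_mdeg_lt /leq_trans; apply.
by rewrite big_rmcond //= => mu /memN_msupp_eq0 ->; rewrite scale0r.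
Qed.

Lemma mlift_is_linear : linear mlift.
Proof.
move=> z b c; pose_big_enough d.
  rewrite !(mliftwE (d := d)) // scaler_sumr -big_split; apply: eq_bigr => mu _.
  by rewrite /= mcoeffD mcoeffZ scalerDl scalerA.
by close.
Qed.

Canonical mlift_lin : {linear {mpoly k[m]} -> W} := HB.pack mlift
  (GRing.isLinear.Build k {mpoly k[m]} W _ mlift mlift_is_linear).

Lemma mliftX mu : mlift 'X_[mu] = g mu.
Proof. by rewrite /mlift msuppX big_seq1 mcoeffX eqxx scale1r. Qed.

End MpolyLift.

Section LayerQuotients.
Variables (k : fieldType) (V : grmod (loop_sl2 k)) (u0 : V) (n : nat).
Hypothesis k0 : [pchar k] =i pred0.
Hypothesis ee_u0 : forall j, gm_act V (sl2_e, j) u0 = 0.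
Hypothesis hh_u0 : forall j, gm_act V (sl2_h, j) u0 = 0.
Hypothesis u0_comp : gm_comp V 0 u0.
Hypothesis V_ind : forall S : V -> Prop, S 0 ->
  (forall c u v, S u -> S v -> S (c *: u + v)) ->
  (forall x v, S v -> S (gm_act V x v)) -> S u0 -> forall v, S v.
Hypothesis verma_hom : forall a : 'I_n -> k, (forall i, a i != 0) ->
  exists2 Th : {linear V -> {mpoly k[n]}},
    forall x v, Th (gm_act V x v) = verma_act a x (Th v) & Th u0 = 1.
Local Notation Ln := (lowest_layer V n).
Local Notation lword := (lword hh_u0).
Implicit Types (a : 'I_n -> k) (chi eta : 'I_n -> int).

Definition mon_sym a chi : k := \sum_(s : 'S_n) \prod_i a (s i) ^ chi i.

Lemma layer_functional a : (forall i, a i != 0) -> exists2 lam : {scalar Ln},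
  forall chi, lam (lword chi) = mon_sym a chi &
  forall j v, lam (gm_act Ln j v) = (- 2%:R * \sum_i a i ^ j) * lam v.
Proof.
move=> a0; have [Th Th_act Th_u0] := verma_hom a0.
exists (coef_ones Th : {scalar Ln}); last exact: coef_ones_act.
move=> chi; rewrite /= /coef_ones (Th_fword Th_act Th_u0) big_map big_enum /=.
exact: mcoeff_ones_prod.
Qed.

(** The layer is cyclic: applied to f(0)^n u0, the operator realizing [lsym chi] gives n! times the
    word of [chi]. *)
Lemma lword_in_sub (S : grsubmod Ln) : lword (fun=> 0) \in S ->
  forall v, v \in S.
Proof.
move=> S0 v; have c0 : n`!%:R != 0 :> k by rewrite ((pcharf0P _).1 k0) -lt0n fact_gt0.
elim: (lword_span ee_u0 hh_u0 V_ind k0 v) => [|c _ w [chi ->] _ IH];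
  first exact: rpred0.
rewrite rpredD // rpredZ //.
have [T hT TE] := lsym_realizable hh_u0 k0 chi.
have := hop_closed hT (@gs_act _ _ _ S) S0; rewrite TE /lsym.
rewrite (eq_bigr (fun=> lword chi)) => [|s _]; last first.
  by rewrite -(lword_perm hh_u0 chi s); apply: eq_lword => i; rewrite add0r.
rewrite sumr_const card_Sn -scaler_nat => /(rpredZ n`!%:R^-1).
by rewrite scalerA mulVf // scale1r.
Qed.

Lemma lword0_comp : gm_comp Ln 0 (lword (fun=> 0)).
Proof.
rewrite /= /sub_comp /= /fchi; elim: (enum _) => [|i s IH] //=.
by have := gm_act_comp ((sl2_f, 0) : loop_sl2 k) IH.
Qed.

(** * The homomorphism onto W(phi) given by a point *)

Section Character.
Variables (a : 'I_n -> k) (phi : int -> k) (lam : {scalar Ln}).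
Hypothesis phiE : forall j, phi j = - 2%:R * \sum_i a i ^ j.
Hypothesis lamE : forall chi, lam (lword chi) = mon_sym a chi.
Hypothesis lam_act : forall j v,
  lam (gm_act Ln j v) = (- 2%:R * \sum_i a i ^ j) * lam v.

Let lam_phi j v : lam (gm_act Ln j v) = phi j * lam v.
Proof. by rewrite lam_act phiE. Qed.

Let psi_hom : grhom (glift phi lam) := glift_hom lam_phi.

Lemma character_lword0 : glift phi lam (lword (fun=> 0)) = n`!%:R *: texp k 0.
Proof.
rewrite (glift_homog _ _ lword0_comp) lamE /mon_sym; congr (_ *: _).
rewrite (eq_bigr (fun=> 1)) ?sumr_const ?card_Sn // => s _.
by apply: big1 => i _; rewrite expr0z.
Qed.

(** The cyclic vector of the layer goes to n! t^0, a non-zero multiple of the generator of W. *)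
Lemma character_image w :
  w \in W_submod phi <-> exists v, glift phi lam v = w.
Proof.
have nf : n`!%:R != 0 :> k by rewrite ((pcharf0P _).1 k0) -lt0n fact_gt0.
split=> [/asboolP[u <-]|[v <-]].
  elim: (env_comp_span u) => [|c _ q [m ->] _ [v vE]].
    by exists 0; rewrite !linear0.
  suff [v' v'E] : exists v', glift phi lam v' = phi_tilde phi (env_pi _ (freeword k m)).
    by exists (c *: v' + v); rewrite [RHS]linearP /= -v'E -vE; exact: linearP.
  rewrite /= [phi_tilde _ _]env_lift_pi free_eval_word.
  elim: (m : seq _) => [|j s [v' v'E]].
    exists (n`!%:R^-1 *: lword (fun=> 0)).
    by rewrite linearZ /= character_lword0 scalerA mulVf // scale1r big_nil.
  exists (gm_act Ln j v'); rewrite big_cons; apply: etrans (psi_hom.1 j v') _.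
  exact: (congr1 (fun q : laurent_mod phi => gm_act (laurent_mod phi) j q) v'E).
apply: (lword_in_sub (S := comap_submod psi_hom (W_submod phi))).
suff H : glift phi lam (lword (fun=> 0)) \in W_submod phi by exact: H.
by rewrite character_lword0 rpredZ //; exact: W_one.
Qed.

Lemma character_isom (N : grsubmod Ln) :
  (forall v, v \in N <-> glift phi lam v = 0) -> grisom (grquot N) (W phi).
Proof.
by move=> NE; apply: (quot_sub_isom psi_hom NE); exact: character_image.
Qed.

(** The image of the kernel in the irreducible quotient by [N] is zero or everything. In the second
    case the cyclic vector would be congruent modulo [N] to an element of the kernel and so be
    killed itself, whereas it goes to n! t^0. *)
Lemma character_maximal (N : grsubmod Ln) : irreducible (grquot N) ->
  (forall v, v \in N -> lam v = 0) -> forall v, v \in N <-> glift phi lam v = 0.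
Proof.
move=> irr Nlam; have NK v : v \in N -> glift phi lam v = 0.
  exact: glift_grsub_eq0.
move=> v; split; first exact: NK.
have pi_hom : grhom (lpi N : {linear Ln -> grquot N}).
  by split=> [j w|j w wj]; [rewrite /= lquot_mapE | exists w].
case: (irr.2 (image_submod pi_hom (ker_submod psi_hom))) => [K0 v0|K1].
  apply/lpi_eq0; apply: K0; apply/asboolP; exists v => //.
  exact/ker_submodE.
have nf : n`!%:R != 0 :> k by rewrite ((pcharf0P _).1 k0) -lt0n fact_gt0.
have /asboolP[w /ker_submodE w0 /lpi_eq/NK] := K1 (lpi N (lword (fun=> 0))).
rewrite linearB /= w0 sub0r character_lword0 => /eqP.
rewrite oppr_eq0 scaler_eq0 (negbTE nf) /= => /eqP E.
by have := laurent_1_neq0 k; rewrite E eqxx.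
Qed.

End Character.

(* The variables of index [lshift n i] and [rshift n i] stand for t_i and
   t_i^-1; [mexp mu] is the exponent of the Laurent monomial [mu]. *)
Definition mexp (mu : 'X_{1..n + n}) (i : 'I_n) : int :=
  (mu (lshift n i))%:Z - (mu (rshift n i))%:Z.

Definition mexp_inv chi : 'X_{1..n + n} :=
  [multinom match split i with
    | inl j => if (0 <= chi j)%R then `|chi j|%N else 0%N
    | inr j => if (0 <= chi j)%R then 0%N else `|chi j|%N end | i < n + n].

Lemma mexp_invK chi : mexp (mexp_inv chi) =1 chi.
Proof.
move=> i; rewrite /mexp !mnmE.
have -> : split (lshift n i) = inl i by exact: (unsplitK (inl i)).
have -> : split (rshift n i) = inr i by exact: (unsplitK (inr i)).
by case: (chi i) => c /=; rewrite ?subr0 // sub0r NegzE.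
Qed.

Lemma mexpD mu nu i : mexp (mu + nu)%MM i = mexp mu i + mexp nu i.
Proof. by rewrite /mexp !mnmDE !PoszD opprD addrACA. Qed.

(** The projection of the polynomials in the t_i and t_i^-1 onto the coinvariants. *)
Definition sym_lword : {mpoly k[n + n]} -> Ln :=
  mlift (fun mu => lword (mexp mu)).

HB.instance Definition _ := GRing.Linear.copy sym_lword
  (mlift (fun mu => lword (mexp mu))).

Lemma sym_lwordX mu : sym_lword 'X_[mu] = lword (mexp mu).
Proof. exact: mliftX. Qed.

(** * The ideal attached to a submodule, and its zeros *)

Section Ideal.
Variable N : grsubmod Ln.

(** By linearity, testing monomial multiples tests all multiples: this is the largest ideal
    projecting into [N]. *)
Definition layer_ideal : {pred {mpoly k[n + n]}} :=
  fun b => `[< forall mu, sym_lword (b * 'X_[mu]) \in N >].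

(** The ideal is proper: if it contained 1, the cyclic vector would lie in [N] and the quotient
    would vanish. *)
Lemma layer_ideal_closed : irreducible (grquot N) -> idealr_closed layer_ideal.
Proof.
move=> [[q q0] _]; split.
- by apply/asboolP => mu; rewrite mul0r linear0 rpred0.
- apply/asboolP => N1; case/eqP: q0; rewrite -(lreprK q); apply/lpi_eq0.
  apply: lword_in_sub; have := N1 (mexp_inv (fun=> 0)).
  by rewrite mul1r sym_lwordX (eq_lword hh_u0 (mexp_invK _)).
- move=> b u v /asboolP uN /asboolP vN; apply/asboolP => mu.
  rewrite mulrDl linearD rpredD //.
  elim/mpolyind: b => [|c nu b _ _ IH]; first by rewrite !mul0r linear0 rpred0.
  rewrite !mulrDl linearD rpredD // -!scalerAl linearZ rpredZ //.
  by rewrite [_ * u]mulrC -mulrA -mpolyXD.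
Qed.

(** All multiples of t_i t_i^-1 - 1 project to zero, so it belongs to the ideal. *)
Lemma layer_ideal_unit (z : 'I_(n + n) -> k) i :
  (forall b, b \in layer_ideal -> b.@[z] = 0) ->
  z (lshift n i) * z (rshift n i) = 1.
Proof.
move=> zP; apply/eqP; rewrite -subr_eq0; apply/eqP.
rewrite -(zP ('X_(lshift n i) * 'X_(rshift n i) - 1)).
  by rewrite mevalB mevalM !mevalXU meval1.
apply/asboolP => mu; rewrite mulrBl mul1r -!mpolyXD linearB /= !sym_lwordX.
rewrite (eq_lword hh_u0 (eta := mexp mu)) ?subrr ?rpred0 // => j.
rewrite !mexpD {1 2}/mexp !mnm1E eq_lshift eq_rlshift eq_rshift eq_lrshift.
by rewrite subr0 sub0r subrr add0r.
Qed.

Lemma meval_mexp (z : 'I_(n + n) -> k) mu :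
  (forall i, z (lshift n i) * z (rshift n i) = 1) ->
  ('X_[mu] : {mpoly k[n + n]}).@[z] = \prod_i z (lshift n i) ^ mexp mu i.
Proof.
move=> zP; rewrite mevalX big_split_ord /= -big_split; apply: eq_bigr => i _ /=.
have z0 : z (lshift n i) != 0.
  by apply: contra_eq_neq (zP i) => ->; rewrite mul0r eq_sym oner_neq0.
have -> : z (rshift n i) = (z (lshift n i))^-1.
  by apply: (mulfI z0); rewrite zP divff.
by rewrite /mexp expfzDr // -exprnP -exprnN exprVn.
Qed.

(* A vector of N is the image of a symmetric Laurent polynomial, whose products
   with monomials act through the h(j); so this polynomial lies in the ideal. *)
Lemma layer_ideal_functional (z : 'I_(n + n) -> k) (lam : {scalar Ln}) :
  (forall b, b \in layer_ideal -> b.@[z] = 0) ->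
  (forall chi, lam (lword chi) = mon_sym (fun i => z (lshift n i)) chi) ->
  forall v, v \in N -> lam v = 0.
Proof.
move=> zP lamE v vN.
have zu i := layer_ideal_unit i zP.
have /choice [T TP] : forall mu, exists T : Ln -> Ln,
    hop T /\ forall chi, T (lword chi) = lsym hh_u0 (mexp mu) chi.
  by move=> mu; have [T hT TE] := lsym_realizable hh_u0 k0 (mexp mu); exists T.
(* The operators [T mu] are uniform in the word, so this claim passes to linear combinations. *)
suff [b bT bl] : exists2 b, forall mu, sym_lword (b * 'X_[mu]) = T mu v & b.@[z] = lam v.
  rewrite -bl; apply: zP; apply/asboolP => mu; rewrite bT.
  by apply: (hop_closed (TP mu).1) vN => j u; exact: gs_act.
have T0 mu : T mu 0 = 0.
  by have := hopP (TP mu).1 (-1) 0 0; rewrite scaler0 addr0 scaleN1r addNr.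
elim: (lword_span ee_u0 hh_u0 V_ind k0 v) => [|c _ w [chi ->] _ [b bT bl]].
  by exists 0 => [mu|]; rewrite ?mul0r ?T0 ?linear0 ?meval0.
(* The symmetrization of t^chi. Its value at [z] is [mon_sym]; moving the permutations onto [mu]
   makes its product with a monomial project to [lsym (mexp mu) chi]. *)
pose B : {mpoly k[n + n]} := \sum_(s : 'S_n) 'X_[mexp_inv (chi \o s)].
exists (c *: B + b) => [mu|]; last first.
  rewrite mevalD mevalZ linearP /= bl lamE; congr (_ * _ + _).
  rewrite raddf_sum /mon_sym (reindex_inj invg_inj); apply: eq_bigr => s _.
  rewrite /= meval_mexp // (reindex_inj (@perm_inj _ s)); apply: eq_bigr => i _.
  by rewrite mexp_invK /= permK.
rewrite mulrDl -scalerAl linearP /= bT (hopP (TP mu).1) (TP mu).2.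
congr (_ *: _ + _); rewrite mulr_suml linear_sum /lsym (reindex_inj invg_inj).
apply: eq_bigr => s _; rewrite -mpolyXD /= sym_lwordX -(lword_perm hh_u0 _ s).
by apply: eq_lword => i; rewrite /= mexpD mexp_invK /= permK.
Qed.

End Ideal.

Theorem layer_irreducible_quotients :
  (forall phi : int -> k, in_Exp n phi ->
     exists N : grsubmod Ln,
       irreducible (grquot N) /\ grisom (W phi) (grquot N)) /\
  (GRing.closed_field_axiom k ->
   forall N : grsubmod Ln, irreducible (grquot N) ->
     exists phi : int -> k, in_Exp n phi /\ grisom (grquot N) (W phi)).
Proof.
split=> [phi phiExp|kcl N irr].
  have [a [a0 phiE]] := phiExp; have [lam lamE lam_act] := layer_functional a0.
  have lam_phi j v : lam (gm_act Ln j v) = phi j * lam v by rewrite lam_act phiE.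
  exists (ker_submod (glift_hom lam_phi)).
  have iso : grisom (grquot (ker_submod (glift_hom lam_phi))) (W phi).
    by apply: (character_isom phiE lamE lam_act) => v; exact: ker_submodE.
  split; last exact: grisom_sym.
  apply: irreducible_isom (grisom_sym iso) _; apply: W_irreducible => j.
  exact: in_Exp_opp phiExp.
have [z zP] := ideal_zero kcl (layer_ideal_closed irr).
have a0 i : z (lshift n i) != 0.
  apply: contra_eq_neq (layer_ideal_unit i zP) => ->.
  by rewrite mul0r eq_sym oner_neq0.
have [lam lamE lam_act] := layer_functional a0.
pose phi j := - 2%:R * \sum_i z (lshift n i) ^ j.
exists phi; split; first by exists (fun i => z (lshift n i)).
apply: (character_isom (phi := phi) (fun=> erefl) lamE lam_act).
apply: (character_maximal (fun=> erefl) lamE lam_act irr).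
exact: layer_ideal_functional zP lamE.
Qed.

End LayerQuotients.

Theorem theorem27 (k : fieldType) (k_char0 : [pchar k]%R =i pred0) (n : nat) :
  (forall phi : int -> k, in_Exp n phi ->
     exists N : grsubmod (layer k n),
       irreducible (grquot N) /\ grisom (W phi) (grquot N)) /\
  (GRing.closed_field_axiom k ->
   forall N : grsubmod (layer k n), irreducible (grquot N) ->
     exists phi : int -> k, in_Exp n phi /\ grisom (grquot N) (W phi)).
Proof.
pose P : {pred loop_sl2 k} := [pred x : loop_sl2 k | x.1 != sl2_f].
apply: (@layer_irreducible_quotients k (M0 k) (ind_one P) n k_char0).
- by move=> j; apply: (@ind_one_act _ (loop_sl2 k)).
- by move=> j; apply: (@ind_one_act _ (loop_sl2 k)).
- exact: (@ind_one_comp _ (loop_sl2 k)).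
- exact: (@induced_ind _ (loop_sl2 k)).
(* The map from [M0] to the product of Verma modules comes from the universal property, as e and h
   kill the constant 1. *)
move=> a a0.
pose rho (x : loop_sl2 k) : {linear {mpoly k[n]} -> {mpoly k[n]}} :=
  verma_act a x.
have rho_br x y v : rho x (rho y v) - rho y (rho x v) = lincomb (rho^~ v) (lie_br x y).
  exact: verma_act_br.
have rho0 x : x \in P -> rho x 1 = 0.
  case: x => -[] j // _; rewrite /= /verma_act big1 // => i _ /=.
    by rewrite -mpolyC1 !mderivC mulr0 oppr0 scaler0.
  by rewrite -mpolyC1 mderivC mulr0 mul0rn oppr0 scaler0.
pose Th : {linear M0 k -> {mpoly k[n]}} := HB.pack (ind_lift rho 1)
  (GRing.isLinear.Build k (induced P) {mpoly k[n]} _ _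
    (ind_lift_is_linear rho_br rho0)).
exists Th; first exact: (ind_lift_act rho_br rho0).
exact: (ind_lift1 rho_br).
Qed.
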